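(* Let $L>0$, let $a$ satisfy (H_a), $h\in L^2(0,L)$, and let $\phi$ satisfy (H_φ), (H_int) and (H_bdd). Then the Cauchy problem (C) has at least one solution, i.e. there exists $v\in H^1(0,L)$ with $\phi(v)\in L^2(0,L)$, $a\frac{dv}{dx}=\phi(v)+h$ in $\mathcal D'(0,L)$ and $v(0)=0$.
   Context: (H_a): $a\in L^\infty(0,L)$ and there are constants $0<\alpha<\beta$ with $\alpha\le a(x)\le\beta$ for a.e. $x\in(0,L)$. (H_φ): $\phi:\mathbb{R}\to\mathbb{R}\cup\{+\infty\}$ is continuous when $\mathbb{R}\cup\{+\infty\}$ carries its usual topology, and $\phi(s)<+\infty$ for every $s\neq0$. (H_int): $\int_0^\delta\phi(t)\,dt<+\infty$ and $\int_{-\delta}^0\phi(t)\,dt<+\infty$ for every $\delta\in(0,1)$. (H_bdd): for every $\delta>0$, $\phi$ is bounded (and continuous) on $\mathbb{R}\setminus(-\delta,\delta)$. Problem (C) with data $(a,h,\phi)$: find $v\in H^1(0,L)$ with $\phi(v)\in L^2(0,L)$, $a\frac{dv}{dx}=\phi(v)+h$ in $\mathcal D'(0,L)$, $v(0)=0$. *)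

(* Defs.v *)
From HB Require Import structures.
From mathcomp Require Import all_boot all_order all_algebra.
From mathcomp Require Import all_classical all_reals all_analysis measurable_realfun.
Set Implicit Arguments. Unset Strict Implicit. Unset Printing Implicit Defensive.
Import Order.TTheory GRing.Theory Num.Theory.
Import numFieldNormedType.Exports.
Local Open Scope classical_set_scope.
Local Open Scope ring_scope.

Section Defs.
Variable R : realType.
Local Notation mu := (@lebesgue_measure R).

Definition ioL (L : R) : set R := `]0, L[.
Definition icc (x y : R) : set R := `[x, y].

Definition smooth (psi : R -> R) : Prop :=
  forall (n : nat) (x : R), derivable (derive1n n psi) x 1.

Definition test_fun (L : R) (psi : R -> R) : Prop :=
  smooth psi /\
  exists c d : R, [/\ 0 < c, c < d, d < L &
     forall x, (x < c \/ d < x) -> psi x = 0].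

Definition L2 (L : R) (f : R -> R) : Prop :=
  measurable_fun (ioL L) f /\
  (\int[mu]_(x in ioL L) ((f x) ^+ 2)%:E < +oo)%E.

Definition weak_deriv (L : R) (v w : R -> R) : Prop :=
  L2 L v /\ L2 L w /\
  forall psi, test_fun L psi ->
    (\int[mu]_(x in ioL L) (v x * derive1 psi x)%:E =
     - \int[mu]_(x in ioL L) (w x * psi x)%:E)%E.

Definition H_a (L : R) (a : R -> R) : Prop :=
  measurable_fun (ioL L) a /\
  exists alpha beta : R, [/\ 0 < alpha, alpha < beta &
    {ae mu, forall x, x \in `]0, L[ -> alpha <= a x <= beta}].

Definition H_phi (phi : R -> \bar R) : Prop :=
  (forall s, phi s != -oo%E) /\ continuous phi /\
  (forall s : R, s != 0 -> (phi s < +oo)%E).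

Definition H_int (phi : R -> \bar R) : Prop :=
  forall delta : R, 0 < delta < 1 ->
    (\int[mu]_(t in icc 0 delta) phi t < +oo)%E /\
    (\int[mu]_(t in icc (- delta) 0) phi t < +oo)%E.

Definition H_bdd (phi : R -> \bar R) : Prop :=
  forall delta : R, 0 < delta ->
    {within [set s | delta <= `|s|], continuous phi} /\
    exists M : R, forall s, delta <= `|s| -> (`|phi s| <= M%:E)%E.

(* phi(v) in L^2(0,L) (phi(v) is \bar R-valued; finiteness a.e. follows) *)
Definition phiv_L2 (L : R) (phi : R -> \bar R) (v : R -> R) : Prop :=
  measurable_fun (ioL L) (fun x => phi (v x)) /\
  (\int[mu]_(x in ioL L) (`|phi (v x)| * `|phi (v x)|) < +oo)%E.

(* v solves (C): v is the continuous representative on [0,L] of an H^1(0,L)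
   function with weak derivative w, phi(v) in L^2, a v' = phi(v) + h in D'(0,L),
   and v(0) = 0 *)
Definition solves_C (L : R) (a h : R -> R) (phi : R -> \bar R) (v : R -> R) : Prop :=
  {within icc 0 L, continuous v} /\
  (exists w : R -> R, weak_deriv L v w /\
    forall psi, test_fun L psi ->
      (\int[mu]_(x in ioL L) (a x * w x * psi x)%:E =
       \int[mu]_(x in ioL L) ((fine (phi (v x)) + h x) * psi x)%:E)%E) /\
  phiv_L2 L phi v /\
  v 0 = 0.
End Defs.

(* Main.v *)
Require Import Defs.
From HB Require Import structures.
From mathcomp Require Import all_boot all_order all_algebra.
From mathcomp Require Import all_classical all_reals all_analysis measurable_realfun.
From mathcomp Require Import ring lra.
Set Implicit Arguments. Unset Strict Implicit. Unset Printing Implicit Defensive.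
Import Order.TTheory GRing.Theory Num.Theory.
Import numFieldNormedType.Exports.
Local Open Scope classical_set_scope.
Local Open Scope ring_scope.

(** Truncate [phi] to [phi_n = min(phi, n)] and run an Euler scheme
    [v_n(x) = int_0^x (phi_n(u_n) + h) / a], with [u_n] a step function close
    to [v_n].  On each Euler cell the increment of the primitive [Phi_n] of
    [phi_n] along [v_n] dominates, up to an error controlled by the mesh,
    [int (phi_n(u_n)^2 + phi_n(u_n) h) / a].  Since [phi] is integrable near
    [0] and bounded away from it, [|Phi_n(s)| <= c0 + c1 |s|] uniformly in [n],
    so that [phi_n(u_n)] is bounded in [L^2] uniformly in [n], and a
    subsequence of [v_n] converges uniformly to some [v].  The uniform [L^2]
    bound passes to [phi(v)], which is therefore finite almost everywhere, and
    it makes the truncation errors of order [1/K]: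
    [0 <= phi_n - phi_K <= phi_n^2 / K] for [n >= K].  Letting first [n] and
    then [K] tend to infinity gives [v(x) = int_0^x (phi(v) + h) / a]. *)

(** * Integrals over compact intervals *)

(** Asking for every segment, whatever the order of its endpoints, frees the calculus rules from
    side conditions. The data [a] and [h] are extended to the whole line accordingly. *)
Definition loc_int (R : realType) (f : R -> R) : Prop :=
  forall x y : R, lebesgue_measure.-integrable `[x, y] (EFin \o f).

Definition iint (R : realType) (x y : R) (f : R -> R) : R :=
  \int[lebesgue_measure]_(t in `[x, y]) f t.

Section IntervalIntegral.
Variable R : realType.
Implicit Types (f g : R -> R) (x y z c : R).
Local Notation mu := (@lebesgue_measure R).

Lemma loc_int_measurable f : loc_int f -> measurable_fun setT f.
Proof.
move=> lf; apply/measurable_EFinP.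
have -> : [set: R] = \bigcup_(n : nat) [set` `[- (n%:R : R), n%:R]].
  rewrite eqEsubset; split => // x _.
  exists (Num.bound `|x|) => //=; rewrite in_itv/= -ler_norml.
  exact/ltW/archi_boundP.
apply/measurable_fun_bigcup => [n|n]; first exact: measurable_itv.
exact: measurable_int (lf _ _).
Qed.

Lemma loc_int_cst c : loc_int (fun _ : R => c).
Proof.
move=> x y; apply: measurable_bounded_integrable => //=.
- by rewrite lebesgue_measure_itv/=; case: ifP => // _; rewrite -EFinD ltry.
- by exists `|c|; split; [exact: num_real|move=> M /ltW cM t _].
Qed.

Lemma loc_int_le f g : measurable_fun setT f -> loc_int g ->
  (forall t, `|f t| <= g t) -> loc_int f.
Proof.
move=> mf lg fg x y; apply: (le_integrable _ _ _ (lg x y)) => //.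
- by apply/measurable_EFinP; exact: measurable_funS mf.
- by move=> t _ /=; rewrite lee_fin (le_trans (fg t))// ler_norm.
Qed.

Lemma loc_intD f g : loc_int f -> loc_int g -> loc_int (fun t => f t + g t).
Proof. by move=> lf lg x y; exact: (integrableD _ (lf x y) (lg x y)). Qed.

Lemma loc_intZ c f : loc_int f -> loc_int (fun t => c * f t).
Proof. by move=> lf x y; exact: (integrableZl _ c (lf x y)). Qed.

Lemma loc_intB f g : loc_int f -> loc_int g -> loc_int (fun t => f t - g t).
Proof. by move=> lf lg x y; exact: (integrableB _ (lf x y) (lg x y)). Qed.

Lemma loc_int_norm f : loc_int f -> loc_int (fun t => `|f t|).
Proof. by move=> lf x y; apply: integrable_norm. Qed.

Lemma loc_int_continuous f : continuous f -> loc_int f.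
Proof.
move=> cf x y; apply: continuous_compact_integrable; first exact: segment_compact.
exact: continuous_subspaceT.
Qed.

Lemma iintD x y f g : loc_int f -> loc_int g ->
  iint x y (fun t => f t + g t) = iint x y f + iint x y g.
Proof. by move=> lf lg; rewrite /iint RintegralD. Qed.

Lemma iintB x y f g : loc_int f -> loc_int g ->
  iint x y (fun t => f t - g t) = iint x y f - iint x y g.
Proof. by move=> lf lg; rewrite /iint RintegralB. Qed.

Lemma iintZ x y c f : loc_int f -> iint x y (fun t => c * f t) = c * iint x y f.
Proof. by move=> lf; rewrite /iint RintegralZl. Qed.

Lemma iint_le x y f g : loc_int f -> loc_int g ->
  (forall t, x <= t <= y -> f t <= g t) -> iint x y f <= iint x y g.
Proof.
by move=> lf lg fg; apply: le_Rintegral => // t /=; rewrite in_itv/=; exact: fg.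
Qed.

Lemma iint_ge0 x y f : (forall t, x <= t <= y -> 0 <= f t) -> 0 <= iint x y f.
Proof.
by move=> f0; apply: Rintegral_ge0 => t /=; rewrite in_itv/=; exact: f0.
Qed.

Lemma iint_norm x y f : loc_int f -> `|iint x y f| <= iint x y (fun t => `|f t|).
Proof. by move=> lf; apply: le_normr_Rintegral. Qed.

Lemma iint_norm_le x y f g : loc_int f -> loc_int g ->
  (forall t, x <= t <= y -> `|f t| <= g t) -> `|iint x y f| <= iint x y g.
Proof.
move=> lf lg fg; apply: le_trans (iint_norm _ _ lf) _.
by apply: iint_le => //; exact: loc_int_norm.
Qed.

Lemma iint_cst x y c : x <= y -> iint x y (fun _ => c) = c * (y - x).
Proof.
move=> xy; transitivity (c * fine (mu `[x, y])).
  by apply: Rintegral_cst; exact: measurable_itv.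
rewrite lebesgue_measure_itv/= lte_fin.
by case: ltgtP xy => [//|//|-> _]; rewrite subrr.
Qed.

Lemma iint_xx x f : iint x x f = 0.
Proof. by rewrite /iint set_itv1 Rintegral_set1. Qed.

Lemma iint_gt x y f : y < x -> iint x y f = 0.
Proof. by move=> yx; rewrite /iint set_itv_ge ?Rintegral_set0// bnd_simp -ltNge. Qed.

Lemma iint_split y x z f : loc_int f -> x <= y -> y <= z ->
  iint x z f = iint x y f + iint y z f.
Proof.
move=> lf xy yz.
have := @Rintegral_itvB R f (BLeft x) (BRight z) y (lf x z).
rewrite !bnd_simp => /(_ xy yz) E.
(* The shared endpoint [y] is a null set, so it may be dropped from the second interval. *)
rewrite /iint -(@Rintegral_itv_obnd_cbnd R y (BRight z) f); last first.
  apply: integrableS (lf y z) => //; exact: subset_itv_oc_cc.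
by rewrite -E addrC subrK.
Qed.

Lemma iint_le_sub x y x' y' f : loc_int f -> (forall t, 0 <= f t) ->
  x' <= x -> y <= y' -> iint x y f <= iint x' y' f.
Proof.
move=> lf f0 xx yy.
have [yx|xy] := ltP y x; first by rewrite iint_gt//; apply: iint_ge0.
rewrite (@iint_split x x' y')//; last exact: le_trans yy.
rewrite (@iint_split y x y')//.
have h1 : 0 <= iint x' x f by apply: iint_ge0.
have h2 : 0 <= iint y y' f by apply: iint_ge0.
by lra.
Qed.

End IntervalIntegral.

(** * Uniform continuity and compactness of families of functions *)

Section UniformContinuity.
Variable R : realType.
Implicit Types (x y e d : R).

Definition unif_cont (v : R -> R) : Prop :=
  forall e, 0 < e -> exists2 d, 0 < d &
    forall x y, `|x - y| <= d -> `|v x - v y| <= e.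

Lemma unif_cont_continuous (v : R -> R) : unif_cont v -> continuous v.
Proof.
move=> uv x; apply/cvgrPdist_le => e /uv[d d0 vd].
near=> y; apply: vd; near: y.
exact: (cvgr_dist_le _ _ cvg_id).
Unshelve. all: by end_near. Qed.

(** Only [x] is confined to the segment: continuity on the whole line controls a full neighbourhood
    of each of its points, and compactness in near-covering form makes [d] uniform. *)
Lemma heine_cantor (f : R -> R) (B : R) : continuous f ->
  forall e, 0 < e -> exists2 d, 0 < d & forall x y,
    `|x| <= B -> `|x - y| <= d -> `|f x - f y| <= e.
Proof.
move=> cf e e0.
have e20 : 0 < e / 2 by rewrite divr_gt0.
have /compact_near_coveringP cK := @segment_compact R (- B) B.
pose P (d : R) x := forall y, `|x - y| <= d -> `|f x - f y| <= e.
have : \forall d \near (0:R)^'+, [set` `[- B, B]] `<=` P d.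
  apply: cK => x _.
  have /cvgrPdist_le/(_ _ e20)/nbhs_ballP[r /= r0 fr] := cf x.
  have r20 : 0 < r / 2 by rewrite divr_gt0.
  (* Halving the radius keeps both [z] and every [y] at distance at most [d] from [z] inside the
     ball of radius [r] about [x]. *)
  exists (ball x (r / 2), [set d | d < r / 2]) => /=.
    split; first exact: nbhsx_ballx.
    exact: nbhs_right_lt.
  case=> z d /= [] xz dr y zy.
  have h1 : `|f x - f z| <= e / 2.
    by apply: fr; apply: lt_le_trans xz _; lra.
  have h2 : `|f x - f y| <= e / 2.
    apply: fr; rewrite /ball/=; move: xz; rewrite /ball/= => xz.
    have -> : x - y = (x - z) + (z - y) by ring.
    by apply: le_lt_trans (ler_normD _ _) _; lra.
  have -> : f z - f y = (f x - f y) - (f x - f z) by ring.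
  by apply: le_trans (ler_normB _ _) _; lra.
move=> H; near (0:R)^'+ => d.
exists d; first by near: d; exact: nbhs_right_gt.
move=> x y xB; have HP : [set` `[- B, B]] `<=` P d by near: d.
by apply: HP; rewrite /= in_itv/= -ler_norml.
Unshelve. all: by end_near. Qed.

(* [v] is the pointwise limit of [V] along an ultrafilter on [nat]; equicontinuity
   makes this limit uniform on compact sets, so no subsequence is extracted. *)
Lemma arzela (V : nat -> R -> R) (B L : R) :
  (forall n x, `|V n x| <= B) ->
  (forall e, 0 < e -> exists2 d, 0 < d &
    forall n x y, `|x - y| <= d -> `|V n x - V n y| <= e) ->
  exists2 v : R -> R, unif_cont v &
    forall e (N : nat), 0 < e -> exists2 n, (N <= n)%N &
      forall x, 0 <= x <= L -> `|V n x - v x| <= e.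
Proof.
move=> VB VE.
have [G [GU ooG]] := @ultraFilterLemma nat \oo _.
have lim x : exists p, forall e, 0 < e -> G [set n | `|V n x - p| <= e].
  have cK := @segment_compact R (- B) B.
  have : ((fun n => V n x) @ G) [set` `[- B, B]].
    apply: (@filterS _ G _ setT); last exact: filterT.
    by move=> n _ /=; rewrite in_itv/= -ler_norml.
  (* A cluster point of an ultrafilter is a limit: if the [e]-neighbourhood of [p] were not in the
     image filter, its complement would be, against clustering. *)
  move/(cK _ _) => [p [_ cp]]; exists p => e e0.
  have [//|GC] := in_ultra_setVsetC [set n | `|V n x - p| <= e] GU.
  have := cp (~` [set y | `|y - p| <= e]) [set y | `|p - y| < e] GC.
  case; first exact: (@nbhsx_ballx _ _ p e e0).
  by move=> y [] /= ny py; exfalso; apply: ny; rewrite distrC ltW.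
have [v vP] := choice lim.
have v_unif : unif_cont v.
  move=> e e0; have e30 : 0 < e / 3 by rewrite divr_gt0.
  have [d d0 Vd] := VE _ e30; exists d => // x y xy.
  have : G ([set n | `|V n x - v x| <= e / 3] `&` [set n | `|V n y - v y| <= e / 3]).
    by apply: filterI; exact: vP.
  move/filter_ex => [n [/= nx ny]].
  have := Vd n x y xy.
  by move: nx ny; rewrite !ler_norml; lra.
exists v => // e N e0.
have e30 : 0 < e / 3 by rewrite divr_gt0.
have [d1 d10 Vd] := VE _ e30; have [d2 d20 vd] := v_unif _ e30.
have /compact_near_coveringP cK := @segment_compact R 0 L.
have : \forall n \near G, [set` `[0, L]] `<=` (fun x => `|V n x - v x| <= e).
  apply: cK => x _.
  exists (ball x (Num.min d1 d2), [set n | `|V n x - v x| <= e / 3]) => /=.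
    by split; [apply: nbhsx_ballx; rewrite lt_min d10|exact: vP].
  case=> z n /= []; rewrite /ball/= lt_min => /andP[/ltW xz1 /ltW xz2] nx.
  have := Vd n x z xz1; have := vd x z xz2.
  by move: nx; rewrite !ler_norml; lra.
move=> H; have HN : G [set n | (N <= n)%N] by apply: ooG; exists N.
have PG : ProperFilter G by exact: ultra_proper.
have [n [/= nL nN]] := @filter_ex _ _ PG _ (@filterI _ _ (@filter_filter _ _ PG) _ _ H HN).
by exists n => // x xL; apply: nL; rewrite /= in_itv.
Qed.

End UniformContinuity.

(** * Signed primitives, and subdivision of an interval into cells *)

Section Primitive.
Variable R : realType.
Implicit Types (f : R -> R) (x y e s : R).

(* The signed primitive vanishing at [0]: [iint x y f] is [0] when [y < x]. *)
Definition prim f s := iint 0 s f - iint s 0 f.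

Lemma prim_sub f x y : loc_int f -> x <= y -> prim f y - prim f x = iint x y f.
Proof.
move=> lf xy; rewrite /prim.
have [x0|x0] := leP 0 x.
  have y0 : iint y 0 f = 0.
    by have [/iint_gt->//|y0] := ltP 0 y; rewrite (_ : y = 0) ?iint_xx//; lra.
  have x00 : iint x 0 f = 0.
    by have [/iint_gt->//|?] := ltP 0 x; rewrite (_ : x = 0) ?iint_xx//; lra.
  by rewrite y0 x00 (iint_split lf x0 xy); ring.
rewrite (iint_gt _ x0).
have [y0|y0] := ltP y 0.
  by rewrite (iint_gt _ y0) (iint_split lf xy (ltW y0)); ring.
have -> : iint y 0 f = 0.
  by have [/iint_gt->//|?] := ltP 0 y; rewrite (_ : y = 0) ?iint_xx//; lra.
by rewrite (iint_split lf (ltW x0) y0); ring.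
Qed.

Lemma prim0 f : prim f 0 = 0.
Proof. by rewrite /prim subrr. Qed.

(** Freezing [f t] at [f x] under the integral costs at most [e] per unit length. The two signs of
    [y - x] are treated apart because [iint] is not oriented. *)
Lemma prim_tangent f x y e : loc_int f ->
  (forall t, `|x - t| <= `|x - y| -> `|f x - f t| <= e) ->
  f x * (y - x) <= prim f y - prim f x + e * `|y - x|.
Proof.
move=> lf fe; have lc c : loc_int (fun _ : R => c) by exact: loc_int_cst.
have [xy|/ltW yx] := leP x y.
  rewrite prim_sub// (ger0_norm (x := y - x)) ?subr_ge0// -!iint_cst//.
  rewrite -iintD//; apply: iint_le => //; first exact: loc_intD.
  move=> t /andP[xt ty]; have : `|f x - f t| <= e.
    by apply: fe; rewrite !ler0_norm; lra.
  by rewrite ler_norml; lra.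
have -> : prim f y - prim f x = - (prim f x - prim f y) by ring.
rewrite prim_sub// distrC (ger0_norm (x := x - y)) ?subr_ge0//.
have -> : f x * (y - x) = - iint y x (fun=> f x) by rewrite iint_cst//; ring.
rewrite -(iint_cst e yx) -lerBlDl.
have -> : - iint y x (fun=> f x) - - iint y x f = iint y x f - iint y x (fun=> f x) by ring.
rewrite -iintB//; apply: iint_le => //; first exact: loc_intB.
move=> t /andP[xt ty]; have : `|f x - f t| <= e.
  by apply: fe; rewrite !ger0_norm; lra.
by rewrite ler_norml; lra.
Qed.

End Primitive.

(** Cut the interval into [N] equal cells of length [L / N <= d] and go from one to the next. This
    serves both to build the Euler scheme and to add up local errors in the integration by parts. *)
Lemma cell_induction (R : realType) (L d : R) (P : R -> Prop) : 0 < L -> 0 < d ->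
  P 0 ->
  (forall s t, 0 <= s -> s <= t -> t <= L -> t - s <= d -> P s -> P t) -> P L.
Proof.
move=> L0 d0 P0 step.
have [N N0 LN] : exists2 N : nat, 0 < (N%:R : R) & L / N%:R <= d.
  exists (Num.bound (L / d)).+1; first by rewrite ltr0n.
  rewrite ler_pdivrMr ?ltr0n// mulrC -ler_pdivrMr//.
  have /ltW := @archi_boundP R (L / d) (ltW (divr_gt0 L0 d0)).
  by move=> /le_trans; apply; rewrite ler_nat.
have PN n : (n <= N)%N -> P (n%:R * (L / N%:R)).
  elim: n => [|n IH] nN; first by rewrite mul0r.
  have LN0 : 0 <= L / N%:R by rewrite divr_ge0 ?ltW.
  apply: step (IH (ltnW nN)).
  - by rewrite mulr_ge0.
  - by rewrite ler_wpM2r// ler_nat.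
  - by rewrite mulrCA ler_piMr ?(ltW L0)// ler_pdivrMr// mul1r ler_nat.
  - by rewrite -mulrBl -natrB// subSnn mul1r.
have NL : N%:R * (L / N%:R) = L by rewrite mulrCA mulfV ?mulr1// gt_eqF.
by have := PN N (leqnn N); rewrite NL; apply.
Qed.

(** * Euler scheme *)

Section LocallySquareIntegrable.
Variable R : realType.
Implicit Types (f g h a : R -> R) (x y c C : R).

Definition sq_loc g := measurable_fun setT g /\ loc_int (fun t => g t ^+ 2).

(** Expand the square of [c] times the modulus of [x], minus 1. The free parameter lets this stand
    in for Cauchy-Schwarz: a small [c] tames the square, then a short interval tames the
    constant. *)
Lemma le_AMGM x c : 0 < c -> `|x| <= c * x ^+ 2 + c^-1.
Proof.
move=> c0; rewrite -(ler_pM2l c0) mulrDr mulfV ?gt_eqF//.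
rewrite -[x ^+ 2]real_normK ?num_real//.
by have := sqr_ge0 (c * `|x| - 1); nra.
Qed.

Lemma sq_loc_loc g : sq_loc g -> loc_int g.
Proof.
move=> [mg lg]; apply: (@loc_int_le _ _ (fun t => 1 * g t ^+ 2 + 1^-1)) => //.
- by apply: loc_intD; [exact: loc_intZ|exact: loc_int_cst].
- by move=> t; exact: le_AMGM.
Qed.

Lemma sq_locM f g : sq_loc f -> sq_loc g -> loc_int (fun t => f t * g t).
Proof.
move=> [mf lf] [mg lg]; apply: (@loc_int_le _ _ (fun t => f t ^+ 2 + g t ^+ 2)).
- exact: measurable_funM.
- exact: loc_intD.
- move=> t; rewrite normrM -[f t ^+ 2]real_normK ?num_real//.
  rewrite -[g t ^+ 2]real_normK ?num_real//.
  have := normr_ge0 (f t); have := normr_ge0 (g t).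
  have := sqr_ge0 (`|f t| - `|g t|); nra.
Qed.

Lemma sq_loc_norm g : sq_loc g -> sq_loc (fun t => `|g t|).
Proof.
move=> [mg lg]; split; first exact: measurableT_comp.
by under eq_fun do rewrite real_normK ?num_real//.
Qed.

Lemma sq_loc_le f g : measurable_fun setT f -> sq_loc g ->
  (forall t, `|f t| <= `|g t|) -> sq_loc f.
Proof.
move=> mf [mg lg] fg; split=> //; apply: loc_int_le lg _.
  exact: measurable_funX.
move=> t; rewrite normrX -[leRHS]real_normK ?num_real//.
by rewrite ler_pXn2r ?nnegrE.
Qed.

Lemma sq_locD f g : sq_loc f -> sq_loc g -> sq_loc (fun t => f t + g t).
Proof.
move=> sf sg; have [[mf lf] [mg lg]] := (sf, sg); split.
  exact: measurable_funD.
rewrite (_ : (fun t => _) = fun t => (f t ^+ 2 + g t ^+ 2) + 2 * (f t * g t)).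
  by apply: loc_intD; [exact: loc_intD|apply: loc_intZ; exact: sq_locM].
by apply/funext => t; ring.
Qed.

Lemma sq_locZ c g : sq_loc g -> sq_loc (fun t => c * g t).
Proof.
move=> [mg lg]; split; first exact: measurable_funM.
under eq_fun do rewrite exprMn; exact: loc_intZ.
Qed.

Lemma sq_loc_cst c : sq_loc (fun=> c).
Proof. by split => //; exact: loc_int_cst. Qed.

Lemma sq_loc_bounded C g : measurable_fun setT g -> (forall t, `|g t| <= C) ->
  sq_loc g.
Proof.
move=> mg gC; apply: (sq_loc_le mg (sq_loc_cst C)) => t.
by apply: le_trans (gC t) (ler_norm _).
Qed.

Lemma iint_norm_AMGM g L x y c : sq_loc g -> 0 <= x -> x <= y -> y <= L -> 0 < c ->
  iint x y (fun t => `|g t|) <= c * iint 0 L (fun t => g t ^+ 2) + c^-1 * (y - x).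
Proof.
move=> sg x0 xy yL c0; have lg2 := sg.2.
apply: (@le_trans _ _ (iint x y (fun t => c * g t ^+ 2 + c^-1))).
  apply: iint_le.
  - exact/loc_int_norm/sq_loc_loc.
  - by apply: loc_intD; [exact: loc_intZ|exact: loc_int_cst].
  - by move=> t _; exact: le_AMGM.
rewrite iintD//; [|exact: loc_intZ|exact: loc_int_cst].
rewrite iint_cst// iintZ// lerD2r ler_pM2l//.
by apply: iint_le_sub => // t; exact: sqr_ge0.
Qed.

(** The right endpoint is a null set. Euler step functions are prescribed on half-open cells, so
    only this form applies to them. *)
Lemma iint_le_co x y f g : loc_int f -> loc_int g ->
  (forall t, x <= t < y -> f t <= g t) -> iint x y f <= iint x y g.
Proof.
move=> lf lg fg; rewrite /iint.
have sub : [set` `[x, y[] `<=` ([set` `[x, y]] : set R) by exact: subset_itv_co_cc.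
have i k : loc_int k -> lebesgue_measure.-integrable [set` `[x, y[] (EFin \o k).
  by move=> lk; exact: integrableS (lk x y).
rewrite -(Rintegral_itv_bndo_bndc (i _ lf)) -(Rintegral_itv_bndo_bndc (i _ lg)).
apply: le_Rintegral; [exact: measurable_itv|exact: i|exact: i|].
by move=> t /=; rewrite in_itv/=; exact: fg.
Qed.

Lemma iint_eq_co x y f g : loc_int f -> loc_int g ->
  (forall t, x <= t < y -> f t = g t) -> iint x y f = iint x y g.
Proof.
by move=> lf lg fg; apply/eqP; rewrite eq_le !iint_le_co// => t /fg ->.
Qed.

End LocallySquareIntegrable.

Section Euler.
Variables (R : realType) (L al be : R) (a h : R -> R).
Hypotheses (L0 : 0 < L) (al0 : 0 < al).
Hypothesis (a_bnd : forall t, al <= a t <= be).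
Hypotheses (ma : measurable_fun setT a) (sh : sq_loc h).
Implicit Types (f g u : R -> R) (x y s t : R).

(** The right-hand side of the equation solved for [v'], with [g] in place of [phi(v)]; a fixed
    point [g = phi(sol g)] is what is sought. *)
Definition rate g t := (g t + h t) / a t.
Definition sol g x := iint 0 x (rate g).

Lemma coef_gt0 t : 0 < a t.
Proof. by have /andP[/(lt_le_trans al0)] := a_bnd t. Qed.

Lemma div_coef_le x t : `|x / a t| <= al^-1 * `|x|.
Proof.
have at0 := coef_gt0 t; rewrite normrM normfV (ger0_norm (ltW at0)) mulrC.
by rewrite ler_wpM2r// lef_pV2// ?posrE//; have /andP[] := a_bnd t.
Qed.

Lemma measurable_inv_coef : measurable_fun setT (fun t => (a t)^-1).
Proof.
have oF : open [set x : R | x != 0] by exact: open_neq.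
apply: (measurable_comp (F := [set x : R | x != 0])) => //.
- exact: open_measurable.
- by move=> _ [t _ <-] /=; rewrite gt_eqF// coef_gt0.
- apply: open_continuous_measurable_fun => // x; rewrite inE /= => x0.
  exact: inv_continuous.
Qed.

Lemma sq_loc_div g : sq_loc g -> sq_loc (fun t => g t / a t).
Proof.
move=> sg; apply: (sq_loc_le _ (sq_locZ al^-1 sg)).
  by apply: measurable_funM => //; [exact: sg.1|exact: measurable_inv_coef].
move=> t; rewrite (normrM al^-1) (ger0_norm (x := al^-1)) ?invr_ge0 ?(ltW al0)//.
exact: div_coef_le.
Qed.

Lemma sq_loc_rate g : sq_loc g -> sq_loc (rate g).
Proof. by move=> sg; apply: sq_loc_div; exact: sq_locD. Qed.

Lemma sol_sub g x y : sq_loc g -> 0 <= x -> x <= y ->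
  sol g y = sol g x + iint x y (rate g).
Proof. by move=> sg x0 xy; apply: iint_split => //; exact/sq_loc_loc/sq_loc_rate. Qed.

Lemma iint_rate_le g x y : sq_loc g ->
  `|iint x y (rate g)| <= al^-1 * (iint x y (fun t => `|g t|) + iint x y (fun t => `|h t|)).
Proof.
move=> sg; have lg := loc_int_norm (sq_loc_loc sg).
have lh := loc_int_norm (sq_loc_loc sh).
rewrite -iintD// -iintZ; last exact: loc_intD.
apply: iint_norm_le; first exact/sq_loc_loc/sq_loc_rate.
  by apply: loc_intZ; exact: loc_intD.
move=> t _; apply: le_trans (div_coef_le _ _) _.
by rewrite ler_pM2l ?invr_gt0// ler_normD.
Qed.

(* A lower bound for [(g + e) * v'] when [v' = rate g] and [|e| <= 1]. *)
Definition energy g t := g t ^+ 2 / be - al^-1 * (`|g t| * `|h t|) - al^-1 * (`|g t| + `|h t|).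

Lemma loc_int_energy g : sq_loc g -> loc_int (energy g).
Proof.
move=> sg; have [sg' sh'] := (sq_loc_norm sg, sq_loc_norm sh).
apply: loc_intB; first apply: loc_intB.
- rewrite (_ : (fun t => _) = fun t => be^-1 * g t ^+ 2); first exact: loc_intZ sg.2.
  by apply/funext => t; rewrite mulrC.
- by apply: loc_intZ; exact: sq_locM.
- by apply: loc_intZ; apply: loc_intD; exact: sq_loc_loc.
Qed.

(** Expand the product into [c ^+ 2 / a], [c * h / a] and [e * rate]. The upper bound on [a]
    controls the first term from below, the lower bound on [a] controls the other two in modulus. *)
Lemma energy_le_rate g t c e : g t = c -> `|e| <= 1 ->
  energy g t <= (c + e) * rate g t.
Proof.
move=> gc e1; have at0 := coef_gt0 t; have /andP[ala abe] := a_bnd t.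
have h1 : c ^+ 2 / be <= c * (c / a t).
  rewrite mulrA -expr2 ler_wpM2l ?sqr_ge0// lef_pV2 ?posrE//.
  exact: lt_le_trans abe.
have h2 : `|c * (h t / a t)| <= al^-1 * (`|c| * `|h t|).
  rewrite normrM mulrCA ler_wpM2l// div_coef_le//.
have h3 : `|e * rate g t| <= al^-1 * (`|c| + `|h t|).
  rewrite normrM; apply: le_trans (ler_piMl _ e1) _ => //.
  apply: le_trans (div_coef_le _ _) _.
  by rewrite ler_pM2l ?invr_gt0// -gc ler_normD.
rewrite /energy gc mulrDl /rate gc; move: h3; rewrite /rate gc.
have -> : c * ((c + h t) / a t) = c * (c / a t) + c * (h t / a t) by ring.
by move: h2; rewrite !ler_norml => /andP[? ?] /andP[? ?]; lra.
Qed.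

(* Along one Euler cell [g] is the constant [f c], and the tangent inequality
   for the primitive of [f] replaces the chain rule. *)
Lemma energy_step f g c s t : loc_int f -> sq_loc g -> s <= t ->
  (forall r, s <= r < t -> g r = f c) ->
  (forall r, `|c - r| <= `|iint s t (rate g)| -> `|f c - f r| <= 1) ->
  iint s t (energy g) <= prim f (c + iint s t (rate g)) - prim f c.
Proof.
move=> lf sg st gc fc; set D := iint s t (rate g).
have lr : loc_int (rate g) by exact/sq_loc_loc/sq_loc_rate.
(* The sign of [e] is opposite to that of [D], so that [e * D] cancels the error term of the tangent
   inequality. *)
pose e : R := if 0 <= D then -1 else 1.
have eD : e * D = - `|D|.
  rewrite /e; case: ifPn => [D0|]; first by rewrite mulN1r ger0_norm.
  by rewrite -ltNge => D0; rewrite mul1r ltr0_norm ?opprK.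
have e1 : `|e| <= 1 by rewrite /e; case: ifP; rewrite ?normrN normr1.
have := @prim_tangent R f c (c + D) 1 lf.
rewrite mul1r (_ : c + D - c = D); last by ring.
rewrite (_ : `|c - (c + D)| = `|D|); last by rewrite opprD addNKr normrN.
move=> /(_ fc) tang.
have : iint s t (energy g) <= (f c + e) * D.
  rewrite -iintZ//.
  apply: iint_le_co; [exact: loc_int_energy|exact: loc_intZ|].
  by move=> r /gc; move/energy_le_rate; exact.
by rewrite mulrDl eD; lra.
Qed.

End Euler.

(** * A priori estimates and construction of the scheme *)

Section APriori.
Variables (R : realType) (L al be : R) (a h : R -> R).
Hypotheses (L0 : 0 < L) (al0 : 0 < al).
Hypothesis (a_bnd : forall t, al <= a t <= be).
Hypotheses (ma : measurable_fun setT a) (sh : sq_loc h).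
Implicit Types (f g u : R -> R) (x y s t : R).

Local Notation rate := (rate a h).
Local Notation sol := (sol a h).
Local Notation energy := (energy al be h).

(** Equi-integrability of an L2 ball. In [iint_norm_AMGM] the parameter [k] makes the quadratic term
    at most [e / 2], and then the length bound [e / 2 * k] does the same for the other term. *)
Lemma iint_norm_small (M e : R) : 0 < e -> exists2 d, 0 < d &
  forall g s t, sq_loc g -> iint 0 L (fun r => g r ^+ 2) <= M ->
    0 <= s -> s <= t -> t <= L -> t - s <= d -> iint s t (fun r => `|g r|) <= e.
Proof.
move=> e0; pose G := `|M|; have G0 : 0 <= G by exact: normr_ge0.
have G10 : 0 < G + 1 by lra.
pose k := e / 2 / (G + 1).
have k0 : 0 < k by rewrite !divr_gt0.
exists (e / 2 * k) => [|g s t sg gM s0 st tL ts]; first by rewrite mulr_gt0// divr_gt0.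
apply: le_trans (iint_norm_AMGM sg s0 st tL k0) _.
have kG : k * iint 0 L (fun r => g r ^+ 2) <= e / 2.
  have -> : e / 2 = k * (G + 1) by rewrite /k; field; rewrite gt_eqF.
  by rewrite ler_pM2l//; have := ler_norm M; rewrite -/G; lra.
have : k^-1 * (t - s) <= e / 2 by rewrite mulrC ler_pdivrMr.
by lra.
Qed.

(** The majorant depends on [C] and [h] only, so the mesh can be fixed before [u] exists. Its outer
    absolute value matches the form of [iint_norm_small]. *)
Lemma rate_cell_le g C s t : sq_loc g -> (forall r, `|g r| <= C) ->
  `|iint s t (rate g)| <= al^-1 * iint s t (fun r => `|C + `|h r| |).
Proof.
move=> sg gC; apply: le_trans (iint_rate_le al0 a_bnd ma sh _ _ sg) _.
have [lg lh] := (loc_int_norm (sq_loc_loc sg), loc_int_norm (sq_loc_loc sh)).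
rewrite -iintD// ler_pM2l ?invr_gt0//; apply: iint_le; first exact: loc_intD.
  by apply: loc_int_norm; apply: loc_intD => //; exact: loc_int_cst.
by move=> r _; apply: le_trans (ler_norm _); rewrite lerD2r.
Qed.

(** On each new cell [u] is frozen at the value of [sol] at the left endpoint. The mesh [de] keeps
    the variation of [sol] on a cell below [eta], for closeness, and below [d], for [energy_step];
    the energy inequalities then telescope. *)
Lemma euler_scheme f C eta : continuous f -> (forall s, `|f s| <= C) -> 0 < eta ->
  exists u, [/\ measurable_fun setT u,
    forall x, 0 <= x <= L -> `|u x - sol (f \o u) x| <= eta &
    iint 0 L (energy (f \o u)) <= prim f (sol (f \o u) L)].
Proof.
move=> cf fC eta0.
have sf u : measurable_fun setT u -> sq_loc (f \o u).
  move=> mu_; apply: (@sq_loc_bounded _ C) => [|t]; last exact: fC.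
  by apply: measurableT_comp => //; exact: continuous_measurable_fun.
have sr u : measurable_fun setT u -> loc_int (rate (f \o u)).
  by move=> mu_; apply/sq_loc_loc/(sq_loc_rate al0 a_bnd) => //; exact: sf.
have le_ u : measurable_fun setT u -> loc_int (energy (f \o u)).
  by move=> mu_; apply: loc_int_energy => //; exact: sf.
pose k r := C + `|h r|.
have sk : sq_loc k by apply: sq_locD; [exact: sq_loc_cst|exact: sq_loc_norm].
(* An a priori bound for [sol] on the whole interval, valid for every [u], so that a single modulus
   [d] serves all cells. *)
pose B := al^-1 * iint 0 L (fun r => `|k r|).
have [d d0 fd] := heine_cantor B cf ltr01.
pose eta' := Num.min eta d.
have eta'0 : 0 < eta' by rewrite lt_min eta0.
have [de de0 hde] := iint_norm_small (iint 0 L (fun r => k r ^+ 2)) (mulr_gt0 al0 eta'0).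
have cell u s t : measurable_fun setT u -> 0 <= s -> s <= t -> t <= L ->
    t - s <= de -> `|iint s t (rate (f \o u))| <= eta'.
  move=> mu_ s0 st tL ts.
  apply: le_trans (rate_cell_le s t (sf _ mu_) (fun r => fC (u r))) _.
  by rewrite mulrC ler_pdivrMr// [leRHS]mulrC; exact: hde.
pose P s := exists u, [/\ measurable_fun setT u,
    forall x, 0 <= x <= s -> `|u x - sol (f \o u) x| <= eta &
    iint 0 s (energy (f \o u)) <= prim f (sol (f \o u) s)].
have step s t : 0 <= s -> s <= t -> t <= L -> t - s <= de -> P s -> P t.
  move=> s0 st tL ts [u [mu_ ueta uen]].
  pose c := sol (f \o u) s.
  (* The point [s] already belongs to the new cell; changing one value there leaves all integrals up
     to [s] intact. *)
  pose u' r := if r < s then u r else c.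
  have mu' : measurable_fun setT u'.
    by apply: measurable_fun_ifT => //; exact: measurable_fun_ltr.
  have u'u x : x < s -> u' x = u x by rewrite /u' => ->.
  have u'c x : s <= x -> u' x = c by rewrite /u' ltNge => ->.
  have solE x : x <= s -> sol (f \o u') x = sol (f \o u) x.
    move=> xs; apply: iint_eq_co; [exact: sr|exact: sr|].
    by move=> r /andP[_ rx]; rewrite /rate /= u'u//; exact: lt_le_trans xs.
  have solS x : s <= x -> sol (f \o u') x = c + iint s x (rate (f \o u')).
    by move=> sx; rewrite (@sol_sub _ _ _ _ _ al0 a_bnd ma sh _ s)// ?solE//; exact: sf.
  exists u'; split; first exact: mu'.
    move=> x /andP[x0 xt]; have [xs|sx] := ltP x s.
      by rewrite u'u// solE ?(ltW xs)//; apply: ueta; rewrite x0 ltW.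
    rewrite u'c// solS// opprD addNKr normrN.
    apply: le_trans (cell _ _ _ mu' s0 sx _ _) _; [lra|lra|].
    by rewrite ge_min lexx.
  rewrite (iint_split (le_ _ mu') s0 st) solS//.
  have -> : iint 0 s (energy (f \o u')) = iint 0 s (energy (f \o u)).
    apply: iint_eq_co; [exact: le_|exact: le_|].
    by move=> r /andP[_ rs]; rewrite /energy /= u'u.
  have lf : loc_int f by exact: loc_int_continuous.
  have : iint s t (energy (f \o u')) <=
      prim f (c + iint s t (rate (f \o u'))) - prim f c.
    apply: energy_step => //; first exact: sf.
      by move=> r /andP[sr_ _] /=; rewrite u'c.
    move=> r; have := cell _ _ _ mu' s0 st tL ts.
    rewrite /eta' le_min => /andP[_ cd] cr; apply: fd; last exact: le_trans cd.
    apply: le_trans (rate_cell_le 0 s (sf _ mu_) (fun r => fC (u r))) _.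
    rewrite ler_pM2l ?invr_gt0//; apply: iint_le_sub => //; last exact: le_trans tL.
    by apply: loc_int_norm; exact: sq_loc_loc.
  by move: uen; rewrite -/c; lra.
have P0 : P 0.
  exists (fun=> 0); split; first exact: measurable_cst.
    move=> x; rewrite -eq_le => /eqP <-.
    by rewrite /sol iint_xx subr0 normr0 ltW.
  by rewrite /sol !iint_xx prim0.
exact: (cell_induction L0 de0 P0 step).
Qed.

(** Coercivity: [energy] is quadratic in [g] up to lower order terms, and [sol g L] grows only
    linearly with the integral of the modulus of [g]. Young's inequality absorbs half of the
    quadratic part. *)
Lemma energy_bound (c0 c1 : R) : 0 <= c1 -> exists M : R, forall g, sq_loc g ->
  iint 0 L (energy g) <= c0 + c1 * `|sol g L| ->
  iint 0 L (fun t => g t ^+ 2) <= M.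
Proof.
move=> c10; have be0 : 0 < be.
  by have /andP[ala abe] := a_bnd 0; apply: lt_le_trans abe; exact: lt_le_trans ala.
(* Total coefficient of the linear terms: [al^-1] from [energy] and [c1 * al^-1] from the bound on
   [sol g L]. The constants [k] and [l] collect the remainders of [e1], [e2], [e3] below. *)
pose D := al^-1 * (1 + c1).
have D0 : 0 <= D by rewrite mulr_ge0 ?invr_ge0 ?(ltW al0)//; lra.
pose k := be * (al^-1) ^+ 2 + 1.
pose l := be * D ^+ 2 + D ^+ 2.
exists (2 * be * (c0 + iint 0 L (fun t => k * h t ^+ 2 + l))) => g sg eg.
have [lg lh] := (loc_int_norm (sq_loc_loc sg), loc_int_norm (sq_loc_loc sh)).
have lgh : loc_int (fun t => `|g t| * `|h t|) by apply: sq_locM; exact: sq_loc_norm.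
have := iint_rate_le al0 a_bnd ma sh 0 L sg; rewrite -/(sol g L) => solL.
have step1 : iint 0 L (fun t => energy g t - c1 * (al^-1 * (`|g t| + `|h t|))) <= c0.
  rewrite iintB; first last.
  - by apply/loc_intZ/loc_intZ; exact: loc_intD.
  - exact: loc_int_energy.
  rewrite (iintZ _ _ c1); last by apply: loc_intZ; exact: loc_intD.
  rewrite (iintZ _ _ al^-1); last exact: loc_intD.
  by rewrite (iintD _ _ lg lh); have := ler_wpM2l c10 solL; lra.
have pw t : (2 * be)^-1 * g t ^+ 2 <=
    (energy g t - c1 * (al^-1 * (`|g t| + `|h t|))) + (k * h t ^+ 2 + l).
  rewrite /energy /k /l -[g t ^+ 2]real_normK ?num_real// -[h t ^+ 2]real_normK ?num_real//.
  set x := `|g t|; set y := `|h t|; set i := al^-1.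
  have -> : (2 * be)^-1 = 2^-1 * be^-1 by rewrite invfM.
  set b := be^-1.
  have b0 : 0 < b by rewrite invr_gt0.
  have bb : be * b = 1 by rewrite mulfV// gt_eqF.
  (* [e1] and [e2] each spend a quarter of [b * x ^+ 2]. Their identities hold for arbitrary [b],
     thanks to a last term carrying the factor [1 - be * b], which is zero. *)
  have e1 : i * (x * y) <= 4^-1 * (b * x ^+ 2) + be * i ^+ 2 * y ^+ 2.
    have -> : 4^-1 * (b * x ^+ 2) + be * i ^+ 2 * y ^+ 2 =
        i * (x * y) + b * (2^-1 * x - be * i * y) ^+ 2 + (1 - be * b) * (be * i ^+ 2 * y ^+ 2 - i * x * y).
      by field.
    by rewrite bb subrr mul0r addr0 lerDl mulr_ge0 ?sqr_ge0// ltW.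
  have e2 : D * x <= 4^-1 * (b * x ^+ 2) + be * D ^+ 2.
    have -> : 4^-1 * (b * x ^+ 2) + be * D ^+ 2 =
        D * x + b * (2^-1 * x - be * D) ^+ 2 + (1 - be * b) * (be * D ^+ 2 - D * x).
      by field.
    by rewrite bb subrr mul0r addr0 lerDl mulr_ge0 ?sqr_ge0// ltW.
  have e3 : D * y <= D ^+ 2 + y ^+ 2.
    by have := sqr_ge0 (D - y); have := sqr_ge0 D; have := sqr_ge0 y; nra.
  have e4 : c1 * (i * (x + y)) = D * x + D * y - i * (x + y).
    by rewrite /D -/i; ring.
  by rewrite e4; lra.
have le1 : loc_int (fun t => energy g t - c1 * (al^-1 * (`|g t| + `|h t|))).
  apply: loc_intB; first exact: loc_int_energy.
  by apply/loc_intZ/loc_intZ; exact: loc_intD.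
have le2 : loc_int (fun t => k * h t ^+ 2 + l).
  by apply: loc_intD; [exact/loc_intZ/sh.2|exact: loc_int_cst].
have : (2 * be)^-1 * iint 0 L (fun t => g t ^+ 2) <= c0 + iint 0 L (fun t => k * h t ^+ 2 + l).
  rewrite -iintZ; last exact: sg.2.
  apply: (@le_trans _ _ (iint 0 L (fun t => (energy g t - c1 * (al^-1 * (`|g t| + `|h t|))) + (k * h t ^+ 2 + l)))).
    by apply: iint_le => //; [exact/loc_intZ/sg.2|exact: loc_intD].
  by rewrite iintD// lerD2r.
by rewrite mulrC ler_pdivrMr ?mulr_gt0// mulrC.
Qed.

(** Equicontinuity of [sol g] over an L2 ball; taking the larger of the two L2 bounds handles [g]
    and [h] with one [d]. *)
Lemma rate_small (M e : R) : 0 < e -> exists2 d, 0 < d &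
  forall g s t, sq_loc g -> iint 0 L (fun r => g r ^+ 2) <= M ->
    0 <= s -> s <= t -> t <= L -> t - s <= d -> `|iint s t (rate g)| <= e.
Proof.
move=> e0; have ae0 : 0 < al * (e / 2) by rewrite mulr_gt0// divr_gt0.
have [d d0 hd] := iint_norm_small (Num.max M (iint 0 L (fun r => h r ^+ 2))) ae0.
exists d => // g s t sg gM s0 st tL ts.
apply: le_trans (iint_rate_le al0 a_bnd ma sh _ _ sg) _.
rewrite mulrC ler_pdivrMr//.
have := hd g s t sg _ s0 st tL ts; rewrite le_max gM => /(_ isT) hg.
have := hd h s t sh _ s0 st tL ts; rewrite le_max lexx orbT => /(_ isT) hh.
by lra.
Qed.

Lemma sol_bounded g M x : sq_loc g -> iint 0 L (fun r => g r ^+ 2) <= M ->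
  0 <= x <= L ->
  `|sol g x| <= al^-1 * (M + iint 0 L (fun r => h r ^+ 2) + 2 * L).
Proof.
move=> sg gM /andP[x0 xL].
apply: le_trans (iint_rate_le al0 a_bnd ma sh _ _ sg) _.
rewrite ler_pM2l ?invr_gt0//.
have := iint_norm_AMGM sg (lexx 0) x0 xL ltr01.
have := iint_norm_AMGM sh (lexx 0) x0 xL ltr01.
by rewrite invr1 !mul1r subr0; lra.
Qed.

Lemma sol_dist g g' k x : sq_loc g -> sq_loc g' -> loc_int k ->
  (forall t, 0 <= t <= x -> `|g t - g' t| <= k t) ->
  `|sol g x - sol g' x| <= al^-1 * iint 0 x k.
Proof.
move=> sg sg' lk gk.
have [lr lr'] : loc_int (rate g) /\ loc_int (rate g').
  by split; apply/sq_loc_loc/(sq_loc_rate al0 a_bnd).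
rewrite /sol -iintB// -iintZ//; apply: iint_norm_le; first exact: loc_intB.
  exact: loc_intZ.
move=> t tx; rewrite (_ : rate g t - rate g' t = (g t - g' t) / a t); last first.
  by rewrite /rate -mulrBl; congr (_ / _); ring.
apply: le_trans (div_coef_le al0 a_bnd _ _) _.
by rewrite ler_pM2l ?invr_gt0// gk.
Qed.

End APriori.

(** * Truncations of the nonlinearity *)

Section Truncation.
Variables (R : realType) (phi : R -> \bar R).
Hypothesis Hphi : H_phi phi.
Implicit Types (s t K : R).

(** Both infinite values are sent to [K]; since [H_phi] excludes [-oo], this is the minimum of
    [phi s] and [K], as a real number. *)
Definition trunc K s : R :=
  match phi s with
  | r%:E => Num.min r K
  | _ => K
  end.

Lemma phi_real_or_pinfty s : (exists r, phi s = r%:E) \/ phi s = +oo%E.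
Proof.
have := Hphi.1 s; case: (phi s) => [r _|_|//]; last by right.
by left; exists r.
Qed.

(** Near a finite value [phi] is real and the minimum with [K] is 1-Lipschitz; near a pole [phi]
    exceeds [K] and the truncation is constant. *)
Lemma trunc_continuous K : continuous (trunc K).
Proof.
move=> s; have cphi : phi t @[t --> s] --> phi s := Hphi.2.1 s.
have [[r phir]|phioo] := phi_real_or_pinfty s.
  have [fin cv] : (\forall t \near s, phi t \is a fin_num) /\
      (fine (phi t) @[t --> s] --> r).
    by move: cphi; rewrite phir => /fine_cvgP.
  apply/cvgrPdist_le => /= e e0.
  have /cvgrPdist_le/(_ e e0) := cv.
  move=> cve; near=> t.
  have : `|r - fine (phi t)| <= e by near: t.
  have : phi t \is a fin_num by near: t.
  have -> : trunc K s = Num.min r K by rewrite /trunc phir.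
  rewrite /trunc; case: (phi t) => [y|//|//] _ /=.
  rewrite !ler_norml.
  case: (leP r K) => ?; case: (leP y K) => ? /andP[? ?]; apply/andP; split; lra.
apply/cvgrPdist_le => /= e e0.
have /cvgeyPgtr/(_ K (num_real K)) : phi t @[t --> s] --> +oo%E.
  by rewrite -phioo.
apply: filterS => t.
rewrite /trunc phioo; case: (phi t) => [y|_|//]; last by rewrite subrr normr0 ltW.
by rewrite lte_fin => Ky; rewrite min_r ?(ltW Ky)// subrr normr0 ltW.
Unshelve. all: by end_near. Qed.

Lemma trunc_le_cst K s : trunc K s <= K.
Proof. by rewrite /trunc; case: (phi s) => // r; rewrite ge_min lexx orbT. Qed.

Lemma trunc_le_phi K s : ((trunc K s)%:E <= phi s)%E.
Proof.
have := Hphi.1 s; rewrite /trunc; case: (phi s) => [r|_|//]; last exact: leey.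
by rewrite lee_fin ge_min lexx.
Qed.

Lemma trunc_homo K K' s : K <= K' -> trunc K s <= trunc K' s.
Proof.
by rewrite /trunc; case: (phi s) => // r KK; rewrite le_min !ge_min lexx KK orbT.
Qed.

(** Where the two truncations differ, the lower one equals [K] and the upper one exceeds [K]. *)
Lemma trunc_sub_le K K' s : 0 < K -> K <= K' ->
  trunc K' s - trunc K s <= K^-1 * trunc K' s ^+ 2.
Proof.
move=> K0 KK'; have KV0 : 0 < K^-1 by rewrite invr_gt0.
have [|lt] := leP (trunc K' s) (trunc K s).
  by rewrite -subr_le0 => /le_trans; apply; rewrite mulr_ge0 ?sqr_ge0// ltW.
have TK : trunc K s = K.
  move: lt; rewrite /trunc; case: (phi s) => [r|//|//].
  by case: (leP r K) => // rK; rewrite min_l ?ltxx// (le_trans rK).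
rewrite -(ler_pM2l K0) mulrA mulfV ?gt_eqF// mul1r.
by move: lt; rewrite TK; nra.
Qed.

(** Truncating at a nonnegative level leaves negative values alone, so squaring preserves
    monotonicity despite the sign of [phi]. *)
Lemma trunc_sqr_homo K K' s : 0 <= K -> K <= K' -> trunc K s ^+ 2 <= trunc K' s ^+ 2.
Proof.
move=> K0 KK'.
have [lt|lt] := leP 0 (trunc K s).
  by have := trunc_homo s KK'; nra.
suff -> : trunc K' s = trunc K s by [].
move: lt; rewrite /trunc; case: (phi s) => [r|/lt_geF|/lt_geF]; rewrite ?K0//.
case: (leP r K) => rK; last by move/lt_geF; rewrite K0.
by rewrite min_l// (le_trans rK).
Qed.

Lemma trunc_eq_phi K s : (phi s <= K%:E)%E -> (trunc K s)%:E = phi s.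
Proof.
have := Hphi.1 s; rewrite /trunc; case: (phi s) => [r|//|//] _.
by rewrite lee_fin => /min_l ->.
Qed.

Lemma cvg_trunc s : (trunc n%:R s)%:E @[n --> \oo] --> phi s.
Proof.
have [[r phir]|phioo] := phi_real_or_pinfty s.
  apply: cvg_near_cst; near=> n; rewrite trunc_eq_phi// phir lee_fin.
  by near: n; exact: nbhs_infty_ger.
rewrite phioo; apply/cvgeyPger => A _; near=> n.
rewrite /trunc phioo lee_fin.
by near: n; exact: nbhs_infty_ger.
Unshelve. all: by end_near. Qed.

Lemma measurable_phi : measurable_fun setT phi.
Proof.
apply: (emeasurable_fun_cvg (fun n s => (trunc n%:R s)%:E)) => [n|s _].
  apply/measurable_EFinP; apply: continuous_measurable_fun.
  exact: (@trunc_continuous n%:R).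
exact: cvg_trunc.
Qed.

Hypothesis Hbdd : H_bdd phi.

(** The radius 1/2 is at once a legitimate [delta] for [H_bdd] here and for [H_int] later. Cutting
    at [K >= 0] does not increase the modulus. *)
Lemma trunc_bounded_away : exists2 M : R, 0 <= M &
  forall K s, 0 <= K -> 2^-1 <= `|s| -> `|trunc K s| <= M.
Proof.
have half : 0 < 2^-1 :> R by rewrite invr_gt0 ltr0n.
have [_ [M hM]] := Hbdd half.
exists `|M| => // K s K0 /hM; rewrite /trunc.
case: (phi s) => [r|//|//]; rewrite lee_fin => rM.
have : `|r| <= `|M| by exact: le_trans rM (ler_norm _).
by rewrite !ler_norml; case: (leP r K) => ? /andP[? ?]; apply/andP; split; lra.
Qed.

(** All truncations at nonnegative levels lie above [trunc 0], which is bounded below by its minimum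
    near 0 and by [H_bdd] elsewhere; hence [m] is independent of [K]. *)
Lemma trunc_lower_bound : exists2 m : R, 0 <= m & forall K s, 0 <= K -> - m <= trunc K s.
Proof.
have [M M0 hM] := trunc_bounded_away.
have half : - 2^-1 <= 2^-1 :> R by lra.
have [c _ hc] := EVT_min half (continuous_subspaceT (@trunc_continuous 0)).
exists (Num.max M (- trunc 0 c)) => [|K s K0]; first by rewrite le_max M0.
apply: le_trans (trunc_homo s K0).
have [sh|hs] := leP (2^-1) `|s|.
  have := hM 0 s (lexx _) sh; rewrite ler_norml => /andP[+ _]; apply: le_trans.
  by rewrite lerN2 le_max lexx.
have : trunc 0 c <= trunc 0 s.
  by apply: hc; rewrite in_itv/= -ler_norml ltW.
have : - trunc 0 c <= Num.max M (- trunc 0 c) by rewrite le_max lexx orbT.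
by lra.
Qed.

Lemma trunc_bounded K : 0 <= K -> exists C, forall s, `|trunc K s| <= C.
Proof.
move=> K0; have [m m0 hm] := trunc_lower_bound; exists (m + K) => s.
by rewrite ler_norml; have := hm K s K0; have := trunc_le_cst K s; lra.
Qed.

Hypothesis Hint : H_int phi.

(** [H_int] speaks of [phi], not of its modulus. The lower bound [- m] makes the negative part
    integrable, hence the positive part too, and the positive part plus [m] dominates every
    truncation in modulus. *)
Lemma iint_trunc_near0 : exists I : R, forall K, 0 <= K ->
  iint 0 2^-1 (fun t => `|trunc K t|) <= I /\
  iint (- 2^-1) 0 (fun t => `|trunc K t|) <= I.
Proof.
have half : 0 < (2^-1 : R) < 1 by rewrite invr_gt0 ltr0n/= invf_lt1// ltr1n.
have [I1 I2] := Hint half.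
have [m m0 hm] := trunc_lower_bound.
have phim s : ((- m)%:E <= phi s)%E.
  by apply: le_trans (trunc_le_phi 0 s); rewrite lee_fin hm.
have key x y : (\int[lebesgue_measure]_(t in icc x y) phi t < +oo)%E ->
    exists I, forall K, 0 <= K -> iint x y (fun t => `|trunc K t|) <= I.
  pose E : set R := icc x y; move=> Ixy.
  have mE : measurable E by exact: measurable_itv.
  have mphi : measurable_fun E phi by apply: measurable_funS measurable_phi.
  have mp : measurable_fun E (phi^\+)%E by exact: measurable_funepos.
  have cstE c : (\int[lebesgue_measure]_(t in E) (cst c%:E t) < +oo)%E.
    apply: integrable_lty => //; exact: (@loc_int_cst R c x y).
  have neg_fin : (\int[lebesgue_measure]_(t in E) phi^\- t < +oo)%E.
    apply: le_lt_trans (cstE m); apply: ge0_le_integral => //.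
    - exact: measurable_funeneg.
    - by move=> t _; rewrite funenegE ge_max lee_fin m0 andbT leeNl phim.
  have pos_fin : (\int[lebesgue_measure]_(t in E) phi^\+ t < +oo)%E.
    have neg_ge0 : (0 <= \int[lebesgue_measure]_(t in E) phi^\- t)%E by exact: integral_ge0.
    move: Ixy; rewrite -/E integralE.
    case: (\int[lebesgue_measure]_(t in E) phi^\- t)%E neg_ge0 neg_fin => // r _ _.
    by case: (\int[lebesgue_measure]_(t in E) phi^\+ t)%E => //= r' _; rewrite ltry.
  pose J := (\int[lebesgue_measure]_(t in E) (phi^\+ t + m%:E))%E.
  have J_fin : (J < +oo)%E.
    by rewrite /J ge0_integralD// lte_add_pinfty//; exact: cstE.
  exists (fine J) => K K0; apply: fine_le.
  - apply: integrable_fin_num => //.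
    exact: (loc_int_norm (loc_int_continuous (@trunc_continuous K)) x y).
  - by rewrite ge0_fin_numE//; apply: integral_ge0 => t _; rewrite adde_ge0.
  apply: ge0_le_integral => //.
  - apply/measurable_EFinP; apply: measurableT_comp => //.
    apply: measurable_funS (continuous_measurable_fun (@trunc_continuous K)) => //.
  - by apply: emeasurable_funD.
  - move=> t _; have := hm K t K0; rewrite funeposE /trunc.
    have := phim t; case: (phi t) => [r| |//]; last first.
      by move=> _ _; rewrite (max_l (leey 0%E)) addye// leey.
    rewrite !lee_fin => rm tm.
    have -> : maxe r%:E 0%E = (Num.max r 0)%:E by rewrite EFin_max.
    rewrite -EFinD lee_fin ler_norml; move: tm.
    by case: (leP r K) => ?; case: (leP r 0) => ? ?; apply/andP; split; lra.
have [J1 h1] := key _ _ I1; have [J2 h2] := key _ _ I2.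
exists (Num.max J1 J2) => K K0; split.
  by apply: le_trans (h1 K K0) _; rewrite le_max lexx.
by apply: le_trans (h2 K K0) _; rewrite le_max lexx orbT.
Qed.

(** The part of the path within 1/2 of the origin contributes at most [I], the rest at most [M] per
    unit length. *)
Lemma prim_trunc_le : exists c0 c1, 0 <= c1 /\ forall K s, 0 <= K ->
  `|prim (trunc K) s| <= c0 + c1 * `|s|.
Proof.
have [I hI] := iint_trunc_near0; have [M M0 hM] := trunc_bounded_away.
exists I, M; split => // K s K0; have [hI1 hI2] := hI K K0.
have lt : loc_int (trunc K) by exact/loc_int_continuous/trunc_continuous.
have ln := loc_int_norm lt.
have half : 0 < 2^-1 :> R by rewrite invr_gt0 ltr0n.
have ns t : 0 <= `|trunc K t| by [].
have [s0|s0] := leP 0 s.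
  have -> : prim (trunc K) s = iint 0 s (trunc K).
    by rewrite -(prim_sub lt s0) prim0 subr0.
  apply: le_trans (iint_norm _ _ lt) _; rewrite (ger0_norm s0).
  have [sh|hs] := leP s 2^-1.
    apply: le_trans (iint_le_sub ln ns (lexx _) sh) _.
    by have := mulr_ge0 M0 s0; lra.
  rewrite (iint_split ln (ltW half) (ltW hs)).
  have : iint 2^-1 s (fun t => `|trunc K t|) <= M * (s - 2^-1).
    rewrite -iint_cst ?(ltW hs)//; apply: iint_le => //; first exact: loc_int_cst.
    by move=> t /andP[ht _]; apply: hM => //; rewrite ger0_norm// (le_trans (ltW half)).
  by have := mulr_ge0 M0 (ltW half); rewrite mulrBr; lra.
have -> : prim (trunc K) s = - iint s 0 (trunc K).
  by rewrite -(prim_sub lt (ltW s0)) prim0 sub0r opprK.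
rewrite normrN; apply: le_trans (iint_norm _ _ lt) _; rewrite (ltr0_norm s0).
have [sh|hs] := leP (- 2^-1) s.
  apply: le_trans (iint_le_sub ln ns sh (lexx _)) _.
  have : 0 <= M * - s by rewrite mulr_ge0// oppr_ge0 ltW.
  by lra.
have h0 : - 2^-1 <= 0 :> R by rewrite oppr_le0 ltW.
rewrite (iint_split ln (ltW hs) h0).
have : iint s (- 2^-1) (fun t => `|trunc K t|) <= M * (- 2^-1 - s).
  rewrite -iint_cst ?(ltW hs)//; apply: iint_le => //; first exact: loc_int_cst.
  move=> t /andP[_ ht]; apply: hM => //.
  by rewrite ler0_norm ?(le_trans ht)// lerNr.
have := mulr_ge0 M0 (ltW half).
by rewrite !mulrBr !mulrN; lra.
Qed.

End Truncation.

(** * Passage to the limit *)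

Section Limit.
Variables (R : realType) (L al be : R) (a h : R -> R) (phi : R -> \bar R).
Hypotheses (L0 : 0 < L) (al0 : 0 < al).
Hypothesis (a_bnd : forall t, al <= a t <= be).
Hypotheses (ma : measurable_fun setT a) (sh : sq_loc h).
Hypotheses (Hphi : H_phi phi) (Hbdd : H_bdd phi) (Hint : H_int phi).
Implicit Types (f g u v : R -> R) (x y s t K M e : R).

Local Notation mu := (@lebesgue_measure R).
Local Notation sol := (sol a h).
Local Notation trunc := (trunc phi).

Lemma sq_loc_trunc K u : 0 <= K -> measurable_fun setT u -> sq_loc (trunc K \o u).
Proof.
move=> K0 mu_; have [C hC] := trunc_bounded Hphi Hbdd K0.
apply: (@sq_loc_bounded _ C) => [|t]; last exact: hC.
apply: measurableT_comp => //; apply: continuous_measurable_fun.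
exact: (@trunc_continuous _ _ Hphi K).
Qed.

(** The constants of [prim_trunc_le] do not depend on the level [n], so neither does the L2 bound
    [M]. *)
Lemma approximations : exists M, exists u : nat -> R -> R, forall n,
  [/\ measurable_fun setT (u n),
   forall x, 0 <= x <= L -> `|u n x - sol (trunc n%:R \o u n) x| <= n.+1%:R^-1 &
   iint 0 L (fun t => (trunc n%:R \o u n) t ^+ 2) <= M].
Proof.
have [c0 [c1 [c10 hc]]] := prim_trunc_le Hphi Hbdd Hint.
have [M hM] := energy_bound L al0 a_bnd ma sh c0 c10.
exists M.
suff H n : exists u, [/\ measurable_fun setT u,
   forall x, 0 <= x <= L -> `|u x - sol (trunc n%:R \o u) x| <= n.+1%:R^-1 &
   iint 0 L (fun t => (trunc n%:R \o u) t ^+ 2) <= M].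
  by have [u hu] := choice H; exists u.
have n0 : 0 <= n%:R :> R by [].
have [C hC] := trunc_bounded Hphi Hbdd n0.
have n10 : 0 < n.+1%:R^-1 :> R by rewrite invr_gt0 ltr0n.
have [u [mu_ ueta uen]] :=
  euler_scheme L0 al0 a_bnd ma sh (@trunc_continuous _ _ Hphi n%:R) hC n10.
exists u; split; [exact: mu_|exact: ueta|].
apply: hM; first exact: sq_loc_trunc.
apply: le_trans uen _; apply: le_trans (ler_norm _) _; exact: hc.
Qed.

(** The projection onto [[0, L]]; being monotone and 1-Lipschitz, it extends [sol] to the line
    without spoiling equicontinuity, as [arzela] requires. *)
Definition clamp x : R := Num.min (Num.max x 0) L.

Lemma clamp_itv x : 0 <= clamp x <= L.
Proof.
by rewrite /clamp le_min le_max lexx orbT (ltW L0) /= ge_min lexx orbT.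
Qed.

Lemma clamp_id x : 0 <= x <= L -> clamp x = x.
Proof. by move=> /andP[x0 xL]; rewrite /clamp max_l// min_l. Qed.

Lemma clamp_homo x y : x <= y -> clamp x <= clamp y /\ clamp y - clamp x <= y - x.
Proof.
move=> xy; rewrite /clamp.
case: (leP x 0) => ?; case: (leP y 0) => ?.
- by split; lra.
- by case: (leP 0 L) => ?; case: (leP y L) => ?; split; lra.
- by split; lra.
- by case: (leP x L) => ?; case: (leP y L) => ?; split; lra.
Qed.

Lemma approximations_cvg : exists M B, exists v, [/\ unif_cont v,
  (forall x, 0 <= x <= L -> `|v x| <= B) &
  forall e (N : nat), 0 < e -> exists2 n, (N <= n)%N & exists u,
   [/\ measurable_fun setT u,
    iint 0 L (fun t => (trunc n%:R \o u) t ^+ 2) <= M,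
    (forall x, 0 <= x <= L -> `|v x - u x| <= e) &
    forall x, 0 <= x <= L -> `|v x - sol (trunc n%:R \o u) x| <= e]].
Proof.
have [M [u hu]] := approximations.
pose g n := trunc n%:R \o u n.
have sg n : sq_loc (g n) by apply: sq_loc_trunc => //; have [] := hu n.
have gM n : iint 0 L (fun t => g n t ^+ 2) <= M by have [] := hu n.
pose V n x := sol (g n) (clamp x).
pose B := al^-1 * (M + iint 0 L (fun r => h r ^+ 2) + 2 * L).
have VB n x : `|V n x| <= B.
  exact: (sol_bounded al0 a_bnd ma sh (sg n) (gM n) (clamp_itv x)).
have VE e : 0 < e -> exists2 d, 0 < d &
    forall n x y, `|x - y| <= d -> `|V n x - V n y| <= e.
  move=> e0; have [d d0 hd] := rate_small L al0 a_bnd ma sh M e0.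
  exists d => // n x y; wlog xy : x y / x <= y => [wl|].
    have [|/ltW yx] := leP x y; first exact: wl.
    by rewrite distrC (distrC (V n x)); exact: wl.
  rewrite ler0_norm ?subr_le0// opprB => xyd.
  have [cxy cd] := clamp_homo xy.
  have /andP[cx0 _] := clamp_itv x; have /andP[_ cyL] := clamp_itv y.
  rewrite distrC /V (sol_sub al0 a_bnd ma sh (sg n) cx0 cxy) addrC addKr.
  exact: hd (sg n) (gM n) cx0 cxy cyL (le_trans cd xyd).
have [v uv hv] := arzela L VB VE.
exists M, (B + 1), v; split=> //.
  move=> x xL; have [n _ hn] := hv 1 0%N ltr01.
  by have := hn x xL; have := VB n x; rewrite !ler_norml; lra.
move=> e N e0; have e20 : 0 < e / 2 by rewrite divr_gt0.
(* Beyond this rank the Euler error [n.+1%:R^-1] is at most [e / 2]. *)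
pose N' := maxn N (Num.bound (e / 2)^-1).
have [n N'n hn] := hv (e / 2) N' e20.
exists n; first exact: leq_trans (leq_maxl _ _) N'n.
have [mu_ ueta uM] := hu n.
have Vsol x : 0 <= x <= L -> `|sol (trunc n%:R \o u n) x - v x| <= e / 2.
  by move=> xL; have := hn x xL; rewrite /V clamp_id.
have ne : n.+1%:R^-1 <= e / 2.
  rewrite -[leRHS]invrK lef_pV2 ?posrE ?ltr0n ?invr_gt0//.
  apply: le_trans (ltW (archi_boundP _)) _; first by rewrite invr_ge0 ltW.
  by rewrite ler_nat; apply: leq_trans (leqnSn _); apply: leq_trans N'n; exact: leq_maxr.
exists (u n); split => // x xL; have := Vsol x xL.
  have := le_trans (ueta x xL) ne; rewrite !ler_norml.
  by move=> /andP[? ?] /andP[? ?]; apply/andP; split; lra.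
rewrite !ler_norml => /andP[? ?]; apply/andP; split; lra.
Qed.

(** For fixed [K] and large [n], go from [v] to [sol (trunc n%:R \o u)], then to
    [sol (trunc K \o u)], then to [sol (trunc K \o v)]. The first and last gaps vanish in the limit,
    by convergence and by continuity of [trunc K]; the middle one is bounded by [trunc_sub_le]. *)
Lemma limit_truncated : exists M v, [/\ unif_cont v,
  (forall K, 0 <= K -> iint 0 L (fun t => trunc K (v t) ^+ 2) <= M) &
  forall K x, 0 < K -> 0 <= x <= L ->
    `|v x - sol (trunc K \o v) x| <= al^-1 * (K^-1 * M)].
Proof.
have [M [B [v [uv vB happ]]]] := approximations_cvg.
have mv : measurable_fun setT v.
  by apply: continuous_measurable_fun; exact: unif_cont_continuous.
have LK c : loc_int (fun _ : R => c) by exact: loc_int_cst.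
have happK K e (N : nat) : 0 < e -> exists2 n, (N <= n)%N & exists u,
   [/\ measurable_fun setT u,
    iint 0 L (fun t => (trunc n%:R \o u) t ^+ 2) <= M,
    (forall x, 0 <= x <= L -> `|trunc K (v x) - trunc K (u x)| <= e) &
    forall x, 0 <= x <= L -> `|v x - sol (trunc n%:R \o u) x| <= e].
  move=> e0; have [d d0 hd] := heine_cantor B (@trunc_continuous _ _ Hphi K) e0.
  have ed0 : 0 < Num.min e d by rewrite lt_min e0.
  have [n Nn [u [mu_ uM vu vsol]]] := happ _ N ed0.
  exists n => //; exists u; split => // x xL.
    by apply: hd; [exact: vB|have := vu x xL; rewrite le_min => /andP[]].
  by have := vsol x xL; rewrite le_min => /andP[].
have le_bound K : exists N : nat, forall n, (N <= n)%N -> K <= n%:R.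
  exists (Num.bound `|K|) => n Nn; apply: le_trans (ler_norm _) _.
  by apply: le_trans (ltW (archi_boundP _)) _; rewrite ?ler_nat.
exists M, v; split => // [K K0|K x K0 xL].
  have [C hC] := trunc_bounded Hphi Hbdd K0.
  have C0 : 0 <= C by apply: le_trans (hC 0).
  apply/ler_addgt0Pr => e e0.
  (* The squares of [trunc K] at [v] and [u] differ by at most [2 * C * e']; the added 1 covers
     [C = 0]. *)
  pose e' := e / (2 * C * L + 1).
  have CL : 0 < 2 * C * L + 1 by rewrite ltr_wpDl// !mulr_ge0// ltW.
  have e'0 : 0 < e' by rewrite divr_gt0.
  have e'e : 2 * C * e' * L <= e.
    have -> : e = (2 * C * L + 1) * e' by rewrite /e' mulrCA mulfV ?mulr1// gt_eqF.
    by lra.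
  have [N hN] := le_bound K.
  have [n Nn [u [mu_ uM vu _]]] := happK K e' N e'0.
  have [sv su] : sq_loc (trunc K \o v) /\ sq_loc (trunc n%:R \o u).
    by split; apply: sq_loc_trunc.
  apply: le_trans (_ : iint 0 L (fun t => (trunc n%:R \o u) t ^+ 2 + 2 * C * e') <= _).
    apply: iint_le; [exact: sv.2|by apply: loc_intD => //; exact: su.2|].
    move=> t tL; have := trunc_sqr_homo phi (u t) K0 (hN n Nn).
    have := vu t tL; have := hC (v t); have := hC (u t).
    rewrite /= !ler_norml => /andP[? ?] /andP[? ?] /andP[? ?] ?.
    have : (trunc K (v t)) ^+ 2 - (trunc K (u t)) ^+ 2 <= 2 * C * e'.
      rewrite subr_sqr; apply: le_trans (ler_norm _) _; rewrite normrM mulrC.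
      by apply: ler_pM => //; rewrite ler_norml; apply/andP; split; lra.
    by lra.
  rewrite iintD//; last exact: su.2.
  by rewrite iint_cst ?(ltW L0)// subr0 lerD.
have /andP[x0 xL'] := xL.
apply/ler_addgt0Pr => e e0.
pose e' := e / (1 + al^-1 * L).
have aL : 0 < 1 + al^-1 * L by rewrite addr_gt0// mulr_gt0 ?invr_gt0.
have e'0 : 0 < e' by rewrite divr_gt0.
have e'e : e' + al^-1 * (e' * L) = e.
  by rewrite mulrCA -[X in X + _]mulr1 -mulrDr /e' -mulrA mulVf ?mulr1// gt_eqF.
have [N hN] := le_bound K.
have [n Nn [u [mu_ uM vu vsol]]] := happK K e' N e'0.
have Kn := hN n Nn.
have sv : sq_loc (trunc K \o v) by apply: sq_loc_trunc => //; exact: ltW.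
have su : sq_loc (trunc K \o u) by apply: sq_loc_trunc => //; exact: ltW.
have sn : sq_loc (trunc n%:R \o u) by apply: sq_loc_trunc.
have lsn : loc_int (fun t => K^-1 * (trunc n%:R \o u) t ^+ 2) by apply/loc_intZ/sn.2.
have KV0 : 0 < K^-1 by rewrite invr_gt0.
have h1 : `|sol (trunc n%:R \o u) x - sol (trunc K \o u) x| <= al^-1 * (K^-1 * M).
  apply: le_trans (sol_dist al0 a_bnd ma sh sn su lsn _) _.
    move=> t _ /=; rewrite ger0_norm ?subr_ge0 ?trunc_homo//.
    exact: trunc_sub_le.
  rewrite ler_pM2l ?invr_gt0// iintZ; last exact: sn.2.
  rewrite ler_pM2l//; apply: le_trans uM; apply: iint_le_sub => //; first exact: sn.2.
  by move=> t; exact: sqr_ge0.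
have h2 : `|sol (trunc K \o u) x - sol (trunc K \o v) x| <= al^-1 * (e' * L).
  apply: le_trans (sol_dist al0 a_bnd ma sh su sv (LK e') _) _.
    by move=> t /andP[t0 tx] /=; rewrite distrC; apply: vu; rewrite t0 (le_trans tx).
  by rewrite iint_cst// subr0 ler_pM2l ?invr_gt0// ler_pM2l.
have := vsol x xL; move: h1 h2; rewrite -e'e.
set A := al^-1 * (K^-1 * M); set A' := al^-1 * (e' * L).
by rewrite !ler_norml; lra.
Qed.

End Limit.

(** * Removal of the truncation: the integral equation *)

Section IntegralSolution.
Variables (R : realType) (L al be : R) (a h : R -> R) (phi : R -> \bar R).
Hypotheses (L0 : 0 < L) (al0 : 0 < al).
Hypothesis (a_bnd : forall t, al <= a t <= be).
Hypotheses (ma : measurable_fun setT a) (sh : sq_loc h).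
Hypotheses (Hphi : H_phi phi) (Hbdd : H_bdd phi) (Hint : H_int phi).
Implicit Types (f g u v : R -> R) (x y s t K M e : R).

Local Notation mu := (@lebesgue_measure R).
Local Notation sol := (sol a h).
Local Notation trunc := (trunc phi).

Lemma cvg_trunc_sqr s :
  ((trunc n%:R s) ^+ 2)%:E @[n --> \oo] --> (`|phi s| * `|phi s|)%E.
Proof.
have [[r phir]|phioo] := phi_real_or_pinfty Hphi s.
  apply: cvg_near_cst; near=> n.
  have : (trunc n%:R s)%:E = phi s.
    rewrite trunc_eq_phi// phir lee_fin.
    by near: n; exact: nbhs_infty_ger.
  by rewrite phir => -[->]; rewrite /= -EFinM -expr2 real_normK// num_real.
rewrite phioo /= mulyy; apply/cvgeyPger => A _; near=> n.
rewrite /trunc phioo lee_fin.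
have An : `|A| <= n%:R by near: n; apply: nbhs_infty_ger; exact: num_real.
have n1 : 1 <= n%:R :> R by near: n; apply: nbhs_infty_ger; exact: num_real.
have := ler_norm A; nra.
Unshelve. all: by end_near. Qed.

(** Monotone convergence, the squares of the truncations being nondecreasing in the level. *)
Lemma phi_sqr_integral_le M v : measurable_fun setT v ->
  (forall K, 0 <= K -> iint 0 L (fun t => trunc K (v t) ^+ 2) <= M) ->
  (\int[mu]_(t in `[0%R, L]) (`|phi (v t)| * `|phi (v t)|) <= M%:E)%E.
Proof.
move=> mv hM.
pose g (n : nat) t := ((trunc n%:R (v t)) ^+ 2)%:E.
have sg n : sq_loc (trunc n%:R \o v) by apply: sq_loc_trunc.
have -> : (\int[mu]_(t in `[0%R, L]) (`|phi (v t)| * `|phi (v t)|))%E =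
    (\int[mu]_(t in `[0%R, L]) limn (g ^~ t))%E.
  by apply: eq_integral => t _; apply/esym/cvg_lim => //; exact: cvg_trunc_sqr.
have cv : (\int[mu]_(t in `[0%R, L]) g n t @[n --> \oo] -->
    \int[mu]_(t in `[0%R, L]) limn (g ^~ t))%E.
  apply: cvg_monotone_convergence => //.
  - by move=> n; exact: measurable_int ((sg n).2 0 L).
  - by move=> n t _; rewrite lee_fin sqr_ge0.
  - by move=> t _ n m nm; rewrite lee_fin trunc_sqr_homo ?ler_nat.
rewrite -(cvg_lim _ cv)//; apply: lime_le; first by apply/cvg_ex; eexists; exact: cv.
apply: nearW => n; rewrite -[leLHS]fineK ?lee_fin.
  exact: hM.
exact: integrable_fin_num ((sg n).2 0 L).
Qed.

Lemma iint_le_ae f g x y : loc_int f -> loc_int g ->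
  (forall t, 0 <= f t) -> (forall t, 0 <= g t) ->
  {ae mu, forall t, icc x y t -> f t <= g t} -> iint x y f <= iint x y g.
Proof.
move=> lf lg f0 g0 fg; apply: fine_le.
- exact: integrable_fin_num (lf x y).
- exact: integrable_fin_num (lg x y).
apply: ae_ge0_le_integral => //.
- by move=> t _; rewrite lee_fin.
- exact: measurable_int (lf x y).
- by move=> t _; rewrite lee_fin.
- exact: measurable_int (lg x y).
Qed.

(** [fine] sends infinite values to 0, so its square is dominated by that of [k]. This serves for
    [phi \o v] as well as for [h]. *)
Lemma sqr_integral_lty_restrict (D : set R) (k : R -> \bar R) : measurable D ->
  measurable_fun D k ->
  (\int[mu]_(t in D) (`|k t| * `|k t|) < +oo)%E ->
  sq_loc ((fine \o k) \_ D).
Proof.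
move=> mD mk kfin.
have mfk : measurable_fun D (fine \o k) by apply: measurableT_comp.
split; first exact: ((measurable_restrictT (fine \o k) mD).1 mfk).
have mkk : measurable_fun D (fun t => `|k t| * `|k t|)%E.
  have mak : measurable_fun D (abse \o k) by exact: measurableT_comp.
  by apply: emeasurable_funM.
have i1 : mu.-integrable D (fun t => `|k t| * `|k t|)%E.
  apply/integrableP; split => //.
  by under eq_integral do rewrite gee0_abs ?mule_ge0//.
have i2 : mu.-integrable D (fun t => (fine (k t) ^+ 2)%:E).
  apply: (le_integrable _ _ _ i1) => //.
    by apply/measurable_EFinP; apply: measurable_funX.
  move=> t _; rewrite [leRHS]gee0_abs ?mule_ge0//.
  case: (k t) => [r| |] /=; rewrite ?lee_fin ?expr0n /= ?normr0 ?mulyy ?leey//.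
  by rewrite normrX expr2.
have i3 : mu.-integrable setT ((fun t => (fine (k t) ^+ 2)%:E) \_ D).
  by apply: (proj1 (integrable_mkcond _ _)) i2 => //.
move=> x y; apply: (@integrableS _ _ _ mu setT) => //.
apply: eq_integrable i3 => //.
by move=> t _; rewrite /= /patch; case: ifPn => // _; rewrite expr0n.
Qed.

(** Replacing [trunc K \o v] by [psi] costs at most [psi ^+ 2 / K] wherever [phi (v t)] is finite,
    so both errors in the equation are of order [1 / K]. *)
Lemma integral_solution : exists v psi, [/\ continuous v,
  forall x, 0 <= x <= L -> v x = sol psi x,
  sq_loc psi,
  forall x, 0 <= x <= L -> psi x = fine (phi (v x)) &
  (\int[mu]_(t in `[0%R, L]) (`|phi (v t)| * `|phi (v t)|) < +oo)%E].
Proof.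
have [M [v [uv hM hv]]] := limit_truncated L0 al0 a_bnd ma sh Hphi Hbdd Hint.
have cv : continuous v by exact: unif_cont_continuous.
have mv := continuous_measurable_fun cv.
have phiM := phi_sqr_integral_le mv hM.
have phi_fin := le_lt_trans phiM (ltry M).
have mphiv : measurable_fun setT (phi \o v).
  by apply: measurableT_comp => //; exact: measurable_phi.
pose psi := (fine \o (phi \o v)) \_ `[0, L].
have psiE x : 0 <= x <= L -> psi x = fine (phi (v x)).
  by move=> xL; rewrite /psi patchE mem_set//= in_itv.
have spsi : sq_loc psi.
  have mD : measurable (icc 0 L) by exact: measurable_itv.
  have mphiD : measurable_fun (icc 0 L) (phi \o v) by exact: measurable_funTS.
  exact: (sqr_integral_lty_restrict mD mphiD phi_fin).
exists v, psi; split => // x xL.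
pose N := iint 0 L (fun t => psi t ^+ 2).
have fin_ae : {ae mu, forall t, icc 0 L t -> phi (v t) \is a fin_num}.
  have i1 : mu.-integrable `[0, L] (fun t => `|phi (v t)| * `|phi (v t)|)%E.
    apply/integrableP; split.
      have mk' : measurable_fun (`[0, L] : set R) (phi \o v) by exact: measurable_funTS.
      have mak : measurable_fun (`[0, L] : set R) (abse \o (phi \o v)) by exact: measurableT_comp.
      by apply: emeasurable_funM.
    by under eq_integral do rewrite gee0_abs ?mule_ge0//.
  have : {ae mu, forall t, icc 0 L t -> (`|phi (v t)| * `|phi (v t)|)%E \is a fin_num}.
    by apply: integrable_ae i1; exact: measurable_itv.
  case=> Z [mZ Z0 sub]; exists Z; split => // t /= nt; apply: sub => /= H.
  by apply: nt => tL; have := H tL; case: (phi (v t)) => [r| |].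
have key K : 0 < K -> `|v x - sol psi x| <= al^-1 * (K^-1 * (M + N)).
  move=> K0.
  have sK : sq_loc (trunc K \o v) by apply: sq_loc_trunc => //; exact: ltW.
  pose d t := `|(trunc K \o v) t - psi t|.
  have d0 t : 0 <= d t by exact: normr_ge0.
  have ld : loc_int d by apply/loc_int_norm/loc_intB; exact: sq_loc_loc.
  have lp : loc_int (fun t => K^-1 * psi t ^+ 2) by apply/loc_intZ/spsi.2.
  have h1 : `|sol (trunc K \o v) x - sol psi x| <= al^-1 * iint 0 x d.
    exact: sol_dist.
  have h2 : iint 0 x d <= K^-1 * N.
    have /andP[x0 xL'] := xL.
    rewrite -iintZ; last exact: spsi.2.
    apply: le_trans (iint_le_sub ld d0 (lexx 0) xL') _.
    apply: iint_le_ae => //.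
      by move=> t; rewrite mulr_ge0 ?invr_ge0 ?sqr_ge0// ltW.
    (* At a point where [phi (v t)] is infinite, [psi] is 0 and the truncation is [K]: the
       inequality fails there and holds only almost everywhere. *)
    have [Z [mZ Z0 sub]] := fin_ae; exists Z; split => // t /= nt.
    apply: sub => /= H; apply: nt => tL; have := H tL.
    have tL' : 0 <= t <= L by move: tL; rewrite /icc /= in_itv.
    rewrite /d /= psiE//.
    rewrite /trunc; case: (phi (v t)) => [r _|//|//] /=.
    case: (leP r K) => rK; first by rewrite subrr normr0 mulr_ge0 ?invr_ge0 ?sqr_ge0// ltW.
    rewrite ltr0_norm ?subr_lt0// opprB -(ler_pM2l K0) mulrA mulfV ?gt_eqF// mul1r.
    by nra.
  have h3 := hv K x K0 xL.
  have h4 : al^-1 * iint 0 x d <= al^-1 * (K^-1 * N) by rewrite ler_pM2l ?invr_gt0.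
  have -> : v x - sol psi x = (v x - sol (trunc K \o v) x) + (sol (trunc K \o v) x - sol psi x).
    by ring.
  apply: le_trans (ler_normD _ _) _; rewrite !mulrDr.
  by apply: lerD => //; apply: le_trans h4.
apply/eqP; rewrite -subr_eq0 -normr_le0 leNgt; apply/negP.
set D := `|_| => D0.
pose Q := al^-1 * `|M + N| + 1.
have Q0 : 0 < Q by rewrite ltr_wpDl// mulr_ge0 ?invr_ge0// ltW.
(* With this level the bound [key] reads [D <= D / 2], a contradiction. *)
have K0 : 0 < 2 * Q / D by rewrite divr_gt0// mulr_gt0.
have := key _ K0; rewrite -/D mulrCA => DK.
have : D <= (2 * Q / D)^-1 * Q.
  apply: le_trans DK _; rewrite ler_pM2l ?invr_gt0//.
  have : al^-1 * (M + N) <= al^-1 * `|M + N|.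
    by rewrite ler_pM2l ?invr_gt0// ler_norm.
  by rewrite /Q; lra.
have -> : (2 * Q / D)^-1 * Q = D / 2 by field; rewrite !gt_eqF.
by lra.
Qed.

End IntegralSolution.

(** * Weak derivatives of primitives *)

Section WeakDerivative.
Variable R : realType.
Implicit Types (f g v w psi : R -> R) (x y s t L e : R).
Local Notation mu := (@lebesgue_measure R).

Lemma smooth_derive_continuous psi : smooth psi -> continuous (derive1 psi).
Proof.
by move=> sp x; apply/differentiable_continuous/derivable1_diffP; exact: (sp 1%N x).
Qed.

Lemma smooth_continuous psi : smooth psi -> continuous psi.
Proof.
by move=> sp x; apply/differentiable_continuous/derivable1_diffP; exact: (sp 0%N x).
Qed.

Lemma iint_derive psi s t : smooth psi -> s <= t ->
  iint s t (derive1 psi) = psi t - psi s.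
Proof.
move=> sp; rewrite le_eqVlt => /orP[/eqP ->|st]; first by rewrite iint_xx subrr.
rewrite /iint /Rintegral (@continuous_FTC2 R (derive1 psi) psi s t st) //.
- by apply: continuous_subspaceT; exact: smooth_derive_continuous.
- split=> [x _||]; first exact: (sp 0%N x).
  + by apply: cvg_at_right_filter; exact: smooth_continuous.
  + by apply: cvg_at_left_filter; exact: smooth_continuous.
Qed.

(* [v psi] and the primitive of [v psi' + w psi] have the same increments on each
   small cell up to [e] times the integral of [|w| + |psi'|]. *)
Lemma integration_by_parts_primitive L w v psi : 0 < L -> loc_int w -> continuous v ->
  (forall x, 0 <= x <= L -> v x = iint 0 x w) -> smooth psi ->
  loc_int (fun t => w t * psi t) ->
  v L * psi L = iint 0 L (fun t => v t * derive1 psi t) + iint 0 L (fun t => w t * psi t).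
Proof.
move=> L0 lw cv vw sp lwp; set p := (derive1 psi).
have cp : continuous p by exact: smooth_derive_continuous.
have cpsi := smooth_continuous sp.
have lp : loc_int p by exact: loc_int_continuous.
have lvp : loc_int (fun t => v t * p t).
  by apply: loc_int_continuous => x; apply: continuousM; [exact: cv|exact: cp].
have lq : loc_int (fun t => v t * p t + w t * psi t) by exact: loc_intD.
rewrite -iintD//; apply/eqP; rewrite -subr_eq0 -normr_le0.
pose k t := `|w t| + `|p t|.
have lk : loc_int k by apply: loc_intD; exact: loc_int_norm.
pose Q s := v s * psi s - iint 0 s (fun t => v t * p t + w t * psi t).
have k0 t : 0 <= k t by rewrite addr_ge0.
suff Qe e : 0 < e -> `|Q L| <= e * iint 0 L k.
  have I0 : 0 <= iint 0 L k by apply: iint_ge0.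
  apply/ler_addgt0Pr => e e0; rewrite add0r.
  have e'0 : 0 < e / (iint 0 L k + 1) by rewrite divr_gt0// ltr_wpDl.
  apply: le_trans (Qe _ e'0) _; rewrite -mulrA ler_piMr ?(ltW e0)//.
  by rewrite mulrC ler_pdivrMr ?ltr_wpDl// mul1r lerDl.
move=> e0.
have [d1 d10 hd1] := heine_cantor L cv e0.
have [d2 d20 hd2] := heine_cantor L cpsi e0.
have d0 : 0 < Num.min d1 d2 by rewrite lt_min d10.
apply: (cell_induction (P := fun s => `|Q s| <= e * iint 0 s k) L0 d0).
  by rewrite /Q vw ?lexx ?(ltW L0)// !iint_xx mul0r subr0 normr0 mulr0.
move=> s t s0 st tL; rewrite le_min => /andP[ts1 ts2] Qs.
have close r : s <= r <= t -> `|v s - v r| <= e /\ `|psi t - psi r| <= e.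
  move=> /andP[sr rt]; split.
    apply: hd1; first by rewrite ger0_norm//; lra.
    by rewrite ler0_norm; lra.
  apply: hd2; first by rewrite ger0_norm//; lra.
  by rewrite ger0_norm; lra.
(* The increment of [v * psi] is [psi t] times the integral of [w] plus [v s] times that of [p]; [j]
   is what remains after subtracting the integrand of [Q]. *)
pose j r := w r * (psi t - psi r) + (v s - v r) * p r.
have lwpt c : loc_int (fun r => c * w r) by exact: loc_intZ.
have lpc c : loc_int (fun r => c * p r) by exact: loc_intZ.
have lj1 : loc_int (fun r => psi t * w r + v s * p r) by exact: loc_intD.
have jE : j = fun r => (psi t * w r + v s * p r) - (v r * p r + w r * psi r).
  by apply/funext => r; rewrite /j; ring.
have lj : loc_int j by rewrite jE; exact: loc_intB.
have QE : Q t = Q s + iint s t j.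
  rewrite jE iintB// iintD// !iintZ// iint_derive//.
  rewrite /Q (iint_split lq s0 st) (vw t) ?(vw s); last 2 first.
  - by rewrite s0 (le_trans st).
  - by rewrite (le_trans s0 st).
  by rewrite (iint_split lw s0 st); ring.
have je : `|iint s t j| <= e * iint s t k.
  rewrite -iintZ//; apply: iint_norm_le => //; first exact: loc_intZ.
  move=> r /close[c1 c2]; rewrite /j /k (mulrDr e).
  apply: le_trans (ler_normD _ _) _; rewrite !normrM; apply: lerD.
    by rewrite mulrC ler_wpM2r.
  by rewrite ler_wpM2r.
rewrite QE (iint_split lk s0 st) mulrDr.
by apply: le_trans (ler_normD _ _) _; exact: lerD Qs je.
Qed.

Lemma integral_ioL L f : loc_int f ->
  (\int[mu]_(x in ioL L) (f x)%:E = (iint 0 L f)%:E)%E.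
Proof.
move=> lf; rewrite /iint /Rintegral fineK; last exact: integrable_fin_num (lf 0 L).
rewrite (@integral_itv_bndoo R 0 L (EFin \o f) true false)//.
by apply/measurable_EFinP; exact: measurable_funTS (loc_int_measurable lf).
Qed.

Lemma sq_loc_L2 L g : sq_loc g -> L2 L g.
Proof.
move=> [mg lg]; split; first exact: measurable_funTS mg.
by rewrite integral_ioL// ltry.
Qed.

(** The boundary term at [L] vanishes with the test function; the one at 0 is absent since the
    primitive starts from 0. *)
Lemma weak_deriv_primitive L v w : 0 < L -> sq_loc w -> continuous v ->
  (forall x, 0 <= x <= L -> v x = iint 0 x w) -> weak_deriv L v w.
Proof.
move=> L0 sw cv vw.
have lv2 : sq_loc v.
  split; first exact: continuous_measurable_fun.
  by apply: loc_int_continuous => x; apply: continuousM; exact: cv.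
split; first exact: sq_loc_L2.
split; first exact: sq_loc_L2.
move=> psi [sp [c [d [c0 cd dL psi0]]]].
have sq_cont f : continuous f -> sq_loc f.
  move=> cf; split; first exact: continuous_measurable_fun.
  by apply: loc_int_continuous => x; apply: continuousM; exact: cf.
have spsi : sq_loc psi by apply: sq_cont; exact: smooth_continuous.
have lwp : loc_int (fun t => w t * psi t) by exact: sq_locM.
have lvp : loc_int (fun t => v t * derive1 psi t).
  by apply: sq_locM => //; apply: sq_cont; exact: smooth_derive_continuous.
rewrite !integral_ioL// -EFinN; congr EFin.
have := integration_by_parts_primitive L0 (sq_loc_loc sw) cv vw sp lwp.
by rewrite (psi0 L) ?mulr0; [lra|right].
Qed.

End WeakDerivative.

(** * Everywhere bounded coefficients, and the Cauchy problem *)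

Section Coefficients.
Variables (R : realType) (L al be : R) (a : R -> R).
Local Notation mu := (@lebesgue_measure R).

(* A representative of [a] satisfying the bounds everywhere, [al] outside [(0, L)]. *)
Definition clamp_coef t : R := Num.min (Num.max ((a \_ (ioL L)) t) al) be.

Lemma clamp_coef_itv t : al <= be -> al <= clamp_coef t <= be.
Proof. by move=> ab; rewrite /clamp_coef le_min le_max lexx orbT ab ge_min lexx orbT. Qed.

Lemma clamp_coef_eq t : t \in `]0, L[ -> al <= a t <= be -> clamp_coef t = a t.
Proof.
move=> tL /andP[ala abe].
by rewrite /clamp_coef patchE mem_set//= max_l// min_l.
Qed.

Lemma measurable_clamp_coef : measurable_fun (ioL L) a -> measurable_fun setT clamp_coef.
Proof.
move=> ma; have mD : measurable (ioL L) by exact: measurable_itv.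
apply: measurable_minr => //; apply: measurable_maxr => //.
exact: ((measurable_restrictT a mD).1 ma).
Qed.

End Coefficients.

Theorem mainTheorem9 (R : realType) (L : R) (a h : R -> R) (phi : R -> \bar R) :
  0 < L -> H_a L a -> L2 L h -> H_phi phi -> H_int phi -> H_bdd phi ->
  exists v : R -> R, solves_C L a h phi v.
Proof.
move=> L0 [ma [al [be [al0 albe a_ae]]]] [mh h2] Hphi Hint Hbdd.
have mD : measurable (ioL L) by exact: measurable_itv.
pose a1 := clamp_coef L al be a.
have a1_bnd t : al <= a1 t <= be by apply: clamp_coef_itv; exact: ltW.
have ma1 : measurable_fun setT a1 by exact: measurable_clamp_coef.
(* The detour through [EFin] fits the extended-real form of [sqr_integral_lty_restrict]. *)
pose h1 := (fine \o (EFin \o h)) \_ (ioL L).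
have sh1 : sq_loc h1.
  apply: (sqr_integral_lty_restrict mD); first exact/measurable_EFinP.
  apply: le_lt_trans h2; rewrite le_eqVlt; apply/orP; left; apply/eqP.
  by apply: eq_integral => t _; rewrite /= -EFinM -expr2 real_normK ?num_real.
have [v [psi [cv vsol spsi psiE phi2]]] :=
  integral_solution L0 al0 a1_bnd ma1 sh1 Hphi Hbdd Hint.
pose w := rate a1 h1 psi.
have sw : sq_loc w by exact: (sq_loc_rate al0 a1_bnd ma1 sh1 spsi).
have mv : measurable_fun setT v by exact: continuous_measurable_fun.
have mphiv : measurable_fun setT (fun x => phi (v x)).
  by apply: (measurableT_comp (measurable_phi Hphi)).
exists v; split; first exact: continuous_subspaceT.
split; last first.
  split; last by rewrite (vsol 0) ?lexx ?(ltW L0)// /sol iint_xx.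
  split; first exact: measurable_funTS.
  apply: le_lt_trans phi2; apply: ge0_subset_integral => //.
  - apply: (@measurable_funTS _ _ _ _ _ (fun x => `|phi (v x)| * `|phi (v x)|)%E).
    by apply: emeasurable_funM; exact: measurableT_comp.
  - exact: subset_itv_oo_cc.
exists w; split; first exact: weak_deriv_primitive.
move=> test [sp _].
have mtest : measurable_fun setT test.
  by apply: continuous_measurable_fun; exact: smooth_continuous.
(* On the open interval [psi] and [h1] agree everywhere with the original terms. What remains is
   [a * w = psi + h1], true wherever [a1 = a], that is almost everywhere. *)
transitivity (\int[lebesgue_measure]_(x in ioL L) ((psi x + h1 x) * test x)%:E)%E; last first.
  apply: eq_integral => x; rewrite inE /ioL /= => xL.
  rewrite psiE; last by move: xL; rewrite in_itv/= => /andP[/ltW -> /ltW ->].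
  by rewrite /h1 patchE mem_set.
apply: ae_eq_integral => //.
- apply/measurable_EFinP; apply: measurable_funM; last exact: measurable_funTS.
  by apply: measurable_funM => //; exact: measurable_funTS sw.1.
- apply/measurable_EFinP; apply: measurable_funTS.
  apply: measurable_funM => //; apply: measurable_funD; [exact: spsi.1|exact: sh1.1].
have [Z [mZ Z0 sub]] := a_ae; exists Z; split => // x /= nx.
apply: sub => /= H; apply: nx => xL.
congr (_%:E); congr (_ * _).
have a1a : a1 x = a x by apply: clamp_coef_eq => //; exact: H.
rewrite -a1a /w /rate mulrC divfK// gt_eqF//.
exact: (coef_gt0 al0 a1_bnd).
Qed.
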